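(* Let $q\ge 3$ be a power of a prime $p$, let $\mathcal{C}$ be the DGZ curve, and let $R=\sum v_P(R)P$ be the ramification divisor of the linear series cut out on $\mathcal{C}$ by lines. Then, for $P\in\mathcal{C}$, $$v_P(R)=\begin{cases} q-2, & P\in\mathcal{C}(\mathbb{F}_{q^2}),\\ 1, & P\in\mathcal{C}(\mathbb{F}_{q^3}),\\ 0, & \text{otherwise.}\end{cases}$$
   Context: Let $\mathbb{K}=\overline{\mathbb{F}}_q$. Put $D_1(x,y,z)=\begin{vmatrix} x & x^q & x^{q^3}\\ y & y^q & y^{q^3}\\ z & z^q & z^{q^3}\end{vmatrix}$, $D_2(x,y,z)=\begin{vmatrix} x & x^q & x^{q^2}\\ y & y^q & y^{q^2}\\ z & z^q & z^{q^2}\end{vmatrix}$ and $F=D_1/D_2$, an absolutely irreducible homogeneous polynomial of degree $q^3-q^2$ over $\mathbb{F}_q$. The DGZ curve $\mathcal{C}$ is the plane curve over $\mathbb{K}$ with equation $F(x,y,z)=0$; its function field is $\mathbb{K}(\mathcal{C})=\mathbb{K}(x,y)$ with $F(x,y,1)=0$. Each point of $\mathcal{C}$ is the center of exactly one branch, so points of $\mathcal{C}$ are identified with points of a nonsingular model $\mathcal{X}$ (places of $\mathbb{K}(\mathcal{C})$), and divisors are divisors on $\mathcal{X}$. $\mathcal{C}(\mathbb{F}_{q^i})$ is the set of points of $\mathcal{C}$ in $PG(2,\mathbb{F}_{q^i})$; $\mathcal{C}(\mathbb{F}_q)=\emptyset$. The function $x$ is a separating variable; $D^{(i)}$ denotes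 the $i$-th Hasse derivative with respect to $x$ and $D=D^{(1)}$. The linear series cut out by lines has order sequence $(0,1,q)$ (the intersection multiplicities of $\mathcal{C}$ with lines through a general point $P$ at $P$). Its ramification divisor is $$R=\mathrm{div}(W_R)+(q+1)\,\mathrm{div}(dx)+3V,\qquad W_R=\begin{vmatrix} x & y & 1\\ D(x) & D(y) & 0\\ D^{(q)}(x) & D^{(q)}(y) & 0\end{vmatrix},$$ where $V$ is the intersection divisor of $\mathcal{C}$ with the line $z=0$ (so $V=\sum qP_i$ over the $q^2-q$ points $P_i$ of $\mathcal{C}$ on that line), and $v_P(R)$ is the coefficient of $P$ in $R$. *)

(* Defs.v *)
From HB Require Import structures.
From mathcomp Require Import all_boot all_order all_algebra.
From mathcomp Require Export mpoly.
From Stdlib Require Import ClassicalEpsilon.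

Set Implicit Arguments.
Unset Strict Implicit.
Unset Printing Implicit Defensive.

Import Order.TTheory GRing.Theory Num.Theory.
Local Open Scope ring_scope.

(** * The curve *)

Section Curve.
Variables (K : fieldType) (q : nat).

(* Determinant with rows (X_i ^ (q ^ e_0), X_i ^ (q ^ e_1), X_i ^ (q ^ e_2)),
   where X_0, X_1, X_2 stand for x, y, z. *)
Definition moore (e : seq nat) : {mpoly K[3]} :=
  \det (\matrix_(i < 3, j < 3) ('X_i ^+ (q ^ nth 0%N e j)%N : {mpoly K[3]})).

Definition D1 : {mpoly K[3]} := moore [:: 0; 1; 3]%N.
Definition D2 : {mpoly K[3]} := moore [:: 0; 1; 2]%N.

(* F = D1 / D2.  Since D2 != 0, this determines the polynomial F. *)
Definition DGZ_polynomial (F : {mpoly K[3]}) : Prop := F * D2 = D1.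

(* Points of PG(2, K) are given by nonzero vectors of homogeneous coordinates. *)
Definition on_curve (F : {mpoly K[3]}) (a : 'rV[K]_3) : Prop :=
  a != 0 /\ F.@[a 0] = 0.

(* The point a lies in PG(2, F_{q^i}): up to a scalar, its coordinates lie in
   F_{q^i}, the set of the c in K with c ^ (q ^ i) = c. *)
Definition rational_point (i : nat) (a : 'rV[K]_3) : Prop :=
  exists2 c : K, c != 0 & forall j, (c * a 0 j) ^+ (q ^ i)%N = c * a 0 j.

Definition curve_points (F : {mpoly K[3]}) (i : nat) (a : 'rV[K]_3) : Prop :=
  on_curve F a /\ rational_point i a.

End Curve.

(** * The function field, its places and its derivations *)

Section FunctionField.
Variables (K L : fieldType) (iota : {rmorphism K -> L}).

(* (L, x, y) is the function field of the irreducible plane curve F = 0 in the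
   affine chart z = 1: the kernel of K[X, Y] -> L, X |-> x, Y |-> y is the ideal
   generated by F(X, Y, 1), and L = K(x, y).  In other words, L is the fraction
   field of K[X, Y] / (F(X, Y, 1)). *)
Definition function_field (F : {mpoly K[3]}) (x y : L) : Prop :=
  let Faff : {mpoly K[2]} := F \mPo [tuple 'X_0; 'X_1; 1] in
  let eval (G : {mpoly K[2]}) : L := mmap iota (tnth [tuple x; y]) G in
  (forall G : {mpoly K[2]}, eval G = 0 <-> exists H, G = H * Faff) /\
  (forall f : L, exists G H, eval H != 0 /\ f = eval G / eval H).

(* Places of L / K, i.e. normalized discrete valuations of L trivial on K.  The
   value at 0, which should be +oo, is set to 0 by convention. *)
Record place := Place {
  ord :> L -> int;
  ord_zero : ord 0 = 0;
  ord_mul : forall f g, f != 0 -> g != 0 -> ord (f * g) = ord f + ord g;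
  ord_add : forall f g, f != 0 -> g != 0 -> f + g != 0 ->
    Num.min (ord f) (ord g) <= ord (f + g);
  ord_const : forall c : K, c != 0 -> ord (iota c) = 0;
  ord_onto : exists t, ord t = 1
}.

Definition divisor := place -> int.

(* div(f), for f != 0 *)
Definition div_fun (f : L) : divisor := fun P => P f.

Definition hcoord (x y : L) : 'I_3 -> L := tnth [tuple x; y; 1].

(* f lies in the maximal ideal of the valuation ring of P. *)
Definition vanishes_at (P : place) (f : L) : Prop := f = 0 \/ 0 < P f.

(* The branch at P is centered at the point a of PG(2, K): for a suitable factor
   h, the residue of (h x : h y : h) at P is a. *)
Definition centered_at (x y : L) (P : place) (a : 'rV[K]_3) : Prop :=
  a != 0 /\
  exists h : L, forall j, vanishes_at P (h * hcoord x y j - iota (a 0 j)).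

(* The intersection divisor of the curve with the line
   l_0 x + l_1 y + l_2 z = 0, for l != 0: the order at P of the linear form
   evaluated at a representative of (x : y : 1) which is primitive at P.
   As P 1 = 0, the convention P 0 = 0 does not affect the minimum below. *)
Definition line_divisor (x y : L) (l : 'rV[K]_3) : divisor := fun P =>
  P (\sum_(j < 3) iota (l 0 j) * hcoord x y j)
  - Num.min (Num.min (P x) (P y)) (P 1).

Definition derivation (d : L -> L) : Prop :=
  (forall c f g, d (iota c * f + g) = iota c * d f + d g) /\
  (forall f g, d (f * g) = f * d g + g * d f).

(* div(dg): its coefficient at P is the order at P of dg / dt = d g, where t is a
   local parameter at P and d is the derivation of L / K with d t = 1.  It does
   not depend on the choice of t. *)
Definition div_diff (g : L) : divisor := fun P =>
  epsilon (inhabits (0 : int)) (fun n : int =>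
    exists (t : L) (d : L -> L),
      [/\ P t = 1, derivation d, d t = 1 & n = P (d g)]).

(* D i is the i-th Hasse derivative with respect to the separating variable x:
   the unique K-linear extension to L of x^m |-> 'C(m, i) x^(m - i) which
   satisfies the Leibniz rule. *)
Definition hasse_derivatives (x : L) (D : nat -> L -> L) : Prop :=
  [/\ forall f, D 0%N f = f,
      forall i c f g, D i (iota c * f + g) = iota c * D i f + D i g,
      forall i f g, D i (f * g) = \sum_(k < i.+1) D k f * D (i - k)%N g
    & forall i m, D i (x ^+ m) = x ^+ (m - i) *+ 'C(m, i)].

(** * The ramification divisor of the linear series cut out by lines *)

Definition W_R (q : nat) (x y : L) (D : nat -> L -> L) : L :=
  \det (\matrix_(i < 3, j < 3)
    nth 0 (nth [::] [:: [:: x; y; 1];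
                        [:: D 1%N x; D 1%N y; 0];
                        [:: D q x; D q y; 0]] i) j).

(* The order sequence is (0, 1, q), and V is the intersection divisor with the
   line z = 0. *)
Definition ramification_divisor (q : nat) (x y : L) (D : nat -> L -> L) :
    divisor := fun P =>
  let V := line_divisor x y (delta_mx 0 ord_max) in
  div_fun (W_R q x y D) P + q.+1%:Z * div_diff x P + 3 * V P.

End FunctionField.

(* Main.v *)
(* For x, y in the function field L, F = 0 says that the points with coordinates
   v = (x, y, 1), v^q and v^(q^3) are collinear; they span the tangent line.
   Being spanned by v^q and v^(q^3), that line has q-th powers as coordinates, so
   applying the q-th Hasse derivative to its equation gives W_R explicitly, and
   v_P(R) becomes the order at P of
     D2 (x^(q^3) - x) / (x^(q^3) - x^q) * (dx / (x^q - x))^(q+1),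
   which is compatible with the changes between the three affine charts.  So let
   P be centered at (a, b) in the chart of x, y; let u = x - a, and let a not
   lie in F_q.  If a is not in F_(q^2), collinearity expresses y through x and
   y^q, so y is a power series in u and u is a uniformizer.  If a and b are in
   F_(q^2), the tangent line w = 0 at P is defined over F_q, collinearity says
   that u is (w/u)^(q-1) times a unit, so w/u is a uniformizer, and u and w have
   orders q - 1 and q. *)
Require Import Defs.
From mathcomp Require Import all_boot all_order all_algebra all_field.
From mathcomp Require Import ring lra zify.

Set Implicit Arguments.
Unset Strict Implicit.
Unset Printing Implicit Defensive.

Import Order.TTheory GRing.Theory Num.Theory.
Local Open Scope ring_scope.

(** * Orders at a place *)

Section Valuation.
Variables (K L : fieldType) (iota : {rmorphism K -> L}) (P : place iota).

(** Places are abstract valuations, so power series are imitated: elements are compared, to every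
    order at [P], with polynomials in a parameter [s] of positive order. If [x] and [y] have such
    expansions, all orders on [K(x, y)] are multiples of [P s], and normalization forces [P s = 1].
    These expansions do not control derivatives, since a derivation is only given algebraically. The
    order of [dx] is therefore read off an exact finite expansion over the field of [q]-th powers,
    which every derivation kills. The equation [D1 = 0] also holds on every line over F_q, as [D2]
    is the product of these lines up to a scalar. Linear independence of [1, x, y] over F_q
    separates the curve from them, and it also excludes places centered at points over F_q. The
    value [q - 2] is [q - q (q - 1) + (q + 1) (q - 2)], the orders of the three factors at a point
    over F_(q^2). At any other point, in a chart whose first coordinate there is outside F_(q^2),
    only [x^(q^3) - x] can contribute. *)

Definition ord_ge (n : int) (f : L) : bool := (f == 0) || (n <= P f).
(** The convention [P 0 = 0] is unfit for comparisons. With [ord_ge] and [ord_eq], zero has order at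
    least every [n], and order exactly [n] for none. *)
Definition ord_eq (n : int) (f : L) : bool := (f != 0) && (P f == n).

Lemma ord_one : P 1 = 0.
Proof. by rewrite -(rmorph1 iota) ord_const ?oner_neq0. Qed.

Lemma ord_opp f : P (- f) = P f.
Proof.
have [->|f0] := eqVneq f 0; first by rewrite oppr0.
have N10 : (-1 : K) != 0 by rewrite oppr_eq0 oner_neq0.
by rewrite -mulN1r ord_mul ?oppr_eq0 ?oner_neq0 // -(rmorphN1 iota) ord_const ?add0r.
Qed.

Lemma ord_ge0 n : ord_ge n 0. Proof. by rewrite /ord_ge eqxx. Qed.

Lemma ord_ge_le m n f : m <= n -> ord_ge n f -> ord_ge m f.
Proof. by move=> mn /orP[/eqP->|nf]; rewrite /ord_ge ?eqxx // (le_trans mn nf) orbT. Qed.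

Lemma ord_geN n f : ord_ge n f -> ord_ge n (- f).
Proof. by rewrite /ord_ge oppr_eq0 ord_opp. Qed.

Lemma ord_geD n f g : ord_ge n f -> ord_ge n g -> ord_ge n (f + g).
Proof.
have [->|f0] := eqVneq f 0; first by rewrite add0r.
have [->|g0] := eqVneq g 0; first by rewrite addr0.
rewrite /ord_ge (negbTE f0) (negbTE g0) /= => nf ng.
have [//|fg0] := eqVneq (f + g) 0; rewrite orFb.
by rewrite (le_trans _ (ord_add P f0 g0 fg0)) // le_min nf ng.
Qed.

Lemma ord_geB n f g : ord_ge n f -> ord_ge n g -> ord_ge n (f - g).
Proof. by move=> nf ng; rewrite ord_geD ?ord_geN. Qed.

Lemma ord_geM m n f g : ord_ge m f -> ord_ge n g -> ord_ge (m + n) (f * g).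
Proof.
have [->|f0] := eqVneq f 0; first by rewrite mul0r !ord_ge0.
have [->|g0] := eqVneq g 0; first by rewrite mulr0 !ord_ge0.
rewrite /ord_ge mulf_eq0 (negbTE f0) (negbTE g0) /= ord_mul // => mf ng.
exact: lerD.
Qed.

Lemma ord_geX n f k : ord_ge n f -> ord_ge (n * k%:Z) (f ^+ k).
Proof.
move=> nf; elim: k => [|k IH]; first by rewrite mulr0 expr0 /ord_ge ord_one lexx orbT.
by rewrite exprS intS mulrDr mulr1 ord_geM.
Qed.

Lemma ord_ge_sum n (I : Type) (r : seq I) (Q : pred I) (f : I -> L) :
  (forall i, Q i -> ord_ge n (f i)) -> ord_ge n (\sum_(i <- r | Q i) f i).
Proof.
move=> nf; elim/big_rec: _ => [|i g Qi ng]; first exact: ord_ge0.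
exact: ord_geD (nf i Qi) ng.
Qed.

Lemma ord_ge_const c : ord_ge 0 (iota c).
Proof.
rewrite /ord_ge; have [->|c0] := eqVneq c 0; first by rewrite rmorph0 eqxx.
by rewrite ord_const // lexx orbT.
Qed.

Lemma ord_ge_nat n : ord_ge 0 (n%:R : L).
Proof. by rewrite -(rmorph_nat iota) ord_ge_const. Qed.

Lemma ord_ge1 : ord_ge 0 1. Proof. exact: (ord_ge_nat 1). Qed.

Lemma ord_gtW f : ord_ge 1 f -> ord_ge 0 f.
Proof. exact: ord_ge_le. Qed.

Lemma ord_eq_neq0 n f : ord_eq n f -> f != 0. Proof. by case/andP. Qed.

Lemma ord_eqP n f : ord_eq n f -> P f = n. Proof. by case/andP=> _ /eqP. Qed.

Lemma ord_eq_ord f : f != 0 -> ord_eq (P f) f.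
Proof. by move=> f0; rewrite /ord_eq f0 eqxx. Qed.

Lemma ord_eq_ge n f : ord_eq n f -> ord_ge n f.
Proof. by case/andP=> f0 /eqP <-; rewrite /ord_ge lexx orbT. Qed.

Lemma ord_eq_const c : c != 0 -> ord_eq 0 (iota c).
Proof. by move=> c0; rewrite /ord_eq fmorph_eq0 c0 ord_const. Qed.

Lemma ord_eq1 : ord_eq 0 1. Proof. by rewrite /ord_eq oner_neq0 ord_one. Qed.

Lemma ord_eqN n f : ord_eq n (- f) = ord_eq n f.
Proof. by rewrite /ord_eq oppr_eq0 ord_opp. Qed.

Lemma ord_eqM m n f g : ord_eq m f -> ord_eq n g -> ord_eq (m + n) (f * g).
Proof.
by case/andP=> f0 /eqP<- /andP[g0 /eqP<-]; rewrite /ord_eq mulf_neq0 //= ord_mul.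
Qed.

Lemma ord_eqX n f k : ord_eq n f -> ord_eq (n * k%:Z) (f ^+ k).
Proof.
move=> nf; elim: k => [|k IH]; first by rewrite mulr0 expr0 ord_eq1.
by rewrite exprS intS mulrDr mulr1 ord_eqM.
Qed.

Lemma ord_eqV n f : ord_eq n f -> ord_eq (- n) f^-1.
Proof.
case/andP=> f0 /eqP <-; rewrite /ord_eq invr_eq0 f0 -addr_eq0 addrC /=.
by rewrite -ord_mul ?invr_eq0 // divff // ord_one.
Qed.

Lemma ord_eqV0 f : ord_eq 0 f -> ord_eq 0 f^-1.
Proof. by move/ord_eqV; rewrite oppr0. Qed.

Lemma ord_eq_div m n f g : ord_eq m f -> ord_eq n g -> ord_eq (m - n) (f / g).
Proof. by move=> mf ng; apply: ord_eqM mf (ord_eqV ng). Qed.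

Lemma ord_eq_lt m n f : ord_eq m f -> ord_ge n f -> n <= m.
Proof. by case/andP=> f0 /eqP <-; rewrite /ord_ge (negbTE f0). Qed.

Lemma ord_eqD n f g : ord_eq n f -> ord_ge (n + 1) g -> ord_eq n (f + g).
Proof.
move=> nf ng.
have fg : ord_ge n (f + g).
  by apply: ord_geD (ord_eq_ge nf) _; apply: ord_ge_le ng; rewrite lerDl.
have fg0 : ~~ ord_ge (n + 1) (f + g).
  apply/negP => fg'; have := ord_geB fg' ng; rewrite addrK => /(ord_eq_lt nf).
  by rewrite gerDl.
move: fg fg0; rewrite /ord_ge /ord_eq; case: eqP => //= _.
by rewrite -ltNge ltzD1 => h1 h2; rewrite eq_le h1 h2.
Qed.

Lemma ord_eqDr n f g : ord_ge (n + 1) f -> ord_eq n g -> ord_eq n (f + g).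
Proof. by rewrite (addrC f) => nf ng; apply: ord_eqD. Qed.

Lemma ord_ge0_eq0 f : ord_ge 0 f -> ~~ ord_ge 1 f -> ord_eq 0 f.
Proof.
rewrite /ord_ge /ord_eq; case: eqP => //= _ f0.
by rewrite -ltNge -[1]add0r ltzD1 => f1; rewrite eq_le f0 f1.
Qed.
End Valuation.

(** [L = K(x, y)] in the form of an induction principle on the elements of [L]. *)
Definition generated_by (K L : fieldType) (iota : K -> L) (x y : L) : Prop :=
  forall S : L -> Prop,
    (forall c, S (iota c)) -> (forall f g, S f -> S g -> S (f + g)) ->
    (forall f g, S f -> S g -> S (f * g)) -> (forall f, S f -> S f^-1) ->
    S x -> S y -> forall f, S f.

(** * Power series expansions *)

Section Approximation.
Variables (K L : fieldType) (iota : {rmorphism K -> L}) (P : place iota).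
Variables (s : L) (k : int).
Hypotheses (k_gt0 : 0 < k) (ord_s : ord_eq P k s).

Let ev (phi : {poly K}) : L := (map_poly iota phi).[s].

Let evD phi psi : ev (phi + psi) = ev phi + ev psi.
Proof. by rewrite /ev rmorphD hornerD. Qed.

Let evM phi psi : ev (phi * psi) = ev phi * ev psi.
Proof. by rewrite /ev rmorphM hornerM. Qed.

Let evC c : ev c%:P = iota c.
Proof. by rewrite /ev map_polyC hornerC. Qed.

Let evX : ev 'X = s.
Proof. by rewrite /ev map_polyX hornerX. Qed.

Let evE phi : (map_poly iota phi).[s] = ev phi.
Proof. by []. Qed.

Let s_ge1 : ord_ge P 1 s.
Proof. by apply: ord_ge_le (ord_eq_ge ord_s); rewrite -gtz0_ge1. Qed.

Let ev_residue phi : exists c, ord_ge P 1 (ev phi - iota c).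
Proof.
elim/poly_ind: phi => [|phi c [c' IH]].
  by exists 0; rewrite -evC subrr ord_ge0.
exists c; rewrite evD evM evX evC addrK -[1]add0r; apply: ord_geM s_ge1.
rewrite -(subrK (iota c') (ev phi)); apply: ord_geD (ord_ge_const _ _).
exact: ord_gtW.
Qed.

Let ev_ge0 phi : ord_ge P 0 (ev phi).
Proof.
have [c /ord_gtW h] := ev_residue phi.
by rewrite -(subrK (iota c) (ev phi)) ord_geD ?ord_ge_const.
Qed.

Let ev_ord phi : ev phi != 0 -> exists j : nat, P (ev phi) = k * j%:Z.
Proof.
elim/poly_ind: phi => [|phi c IH]; first by rewrite -(polyC0) evC rmorph0 eqxx.
rewrite evD evM evX evC; have [->|c0] := eqVneq c 0.
  rewrite rmorph0 addr0 mulf_eq0 negb_or => /andP[phi0 s0].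
  have [j ej] := IH phi0; exists j.+1; rewrite ord_mul // ej (ord_eqP ord_s).
  by rewrite intS mulrDr mulr1 addrC.
move=> _; exists 0%N; rewrite mulr0; apply/ord_eqP/ord_eqDr; last exact: ord_eq_const.
by rewrite addrC; apply: ord_geM (ev_ge0 _) s_ge1.
Qed.

(** A truncated power series in [s], without a completion. The precision counts orders at [P] rather
    than powers of [s], because [P s = k] is not yet known to be 1. *)
Definition approx (N : nat) (f : L) : Prop :=
  exists phi : {poly K}, ord_ge P N%:Z (f - (map_poly iota phi).[s]).

Lemma approx_ge0 N f : approx N f -> ord_ge P 0 f.
Proof.
case=> phi h; rewrite -(subrK (ev phi) f); apply: ord_geD (ev_ge0 phi).
exact: ord_ge_le h.
Qed.

Lemma approx_ge N f : ord_ge P N%:Z f -> approx N f.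
Proof. by exists 0; rewrite evE -polyC0 evC rmorph0 subr0. Qed.

Lemma approx_const N c : approx N (iota c).
Proof. by exists c%:P; rewrite evE evC subrr ord_ge0. Qed.

Lemma approx1 N : approx N 1.
Proof. by rewrite -(rmorph1 iota); apply: approx_const. Qed.

Lemma approx_param N : approx N s.
Proof. by exists 'X; rewrite evE evX subrr ord_ge0. Qed.

Lemma approxD N f g : approx N f -> approx N g -> approx N (f + g).
Proof.
move=> [phi h] [psi h']; exists (phi + psi).
by rewrite evE evD opprD addrACA ord_geD.
Qed.

Lemma approxM N f g : approx N f -> approx N g -> approx N (f * g).
Proof.
move=> af ag; case: (af) (ag) => [phi h] [psi h']; exists (phi * psi).
rewrite evE evM.
have -> : f * g - ev phi * ev psi = (f - ev phi) * g + ev phi * (g - ev psi) by ring.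
apply: ord_geD; first by rewrite -[N%:Z]addr0 ord_geM ?(approx_ge0 ag).
by rewrite -[N%:Z]add0r ord_geM ?ev_ge0.
Qed.

Lemma approxN N f : approx N f -> approx N (- f).
Proof.
by move=> h; rewrite -mulN1r -(rmorphN1 iota); apply: approxM (approx_const _ _) h.
Qed.

Lemma approxB N f g : approx N f -> approx N g -> approx N (f - g).
Proof. by move=> af ag; apply: approxD => //; apply: approxN. Qed.

Lemma approxX N f n : approx N f -> approx N (f ^+ n).
Proof.
move=> h; elim: n => [|n IH]; first by rewrite expr0; apply: approx1.
by rewrite exprS; apply: approxM.
Qed.

Lemma approxV N f : ord_eq P 0 f -> approx N f -> approx N f^-1.
Proof.
move=> f0; case: N => [_|N [phi h]].
  by apply/approx_ge/ord_eq_ge/ord_eqV0.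
have [c hc] := ev_residue phi.
have hfc : ord_ge P 1 (f - iota c).
  rewrite -(subrK (ev phi) f) -addrA ord_geD //; exact: ord_ge_le h.
have c0 : c != 0.
  apply/eqP => c0; move: hfc; rewrite c0 rmorph0 subr0 => /(ord_eq_lt f0).
  by [].
(* A truncated geometric series: [psi] inverts [phi] up to [z ^+ N.+1], and [z] vanishes at [P]
   because [c] is the residue of [phi]. *)
pose z := 1 - c^-1%:P * phi; pose psi := c^-1%:P * \sum_(i < N.+1) z ^+ i.
have zpsi : phi * psi = 1 - z ^+ N.+1.
  by rewrite -opprB subrX1 -mulNr opprB subKr mulrA [phi * _]mulrC.
have z1 : ord_ge P 1 (ev z).
  have -> : ev z = - (iota c^-1) * (ev phi - iota c).
    rewrite /z -[1]/(1%:P) -mulN1r -[-1]/(- 1%:P) -rmorphN evD !evM !evC.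
    rewrite rmorphN rmorph1 !mulNr mul1r mulrBr opprB -rmorphM mulVf // rmorph1.
    by [].
  by rewrite mulNr ord_geN // -[1]add0r ord_geM // ord_ge_const.
exists psi.
have -> : f^-1 - ev psi = f^-1 * (ev z ^+ N.+1 - (f - ev phi) * ev psi).
  have -> : ev z ^+ N.+1 = 1 - ev phi * ev psi.
    rewrite -evM zpsi; have -> : ev z ^+ N.+1 = ev (z ^+ N.+1).
      by rewrite /ev rmorphXn horner_exp.
    have -> : 1 - z ^+ N.+1 = 1%:P + (-1)%:P * z ^+ N.+1 by rewrite polyCN mulN1r.
    by rewrite evD evM !evC rmorphN1 rmorph1; ring.
  by field; apply: ord_eq_neq0 f0.
rewrite -[N.+1%:Z]add0r ord_geM ?ord_geB //.
- exact/ord_eq_ge/ord_eqV0.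
- by rewrite -[N.+1%:Z]mul1r ord_geX.
- by rewrite -[N.+1%:Z]addr0 ord_geM.
Qed.

Lemma approx_div N f g : approx N f -> ord_eq P 0 g -> approx N g -> approx N (f / g).
Proof. by move=> af g0 ag; apply: approxM => //; apply: approxV. Qed.

Lemma approx_param_gain N f : approx N f -> approx N.+1 (s * f).
Proof.
case=> phi h; exists ('X * phi); rewrite evE evM evX -mulrBr intS.
exact: ord_geM.
Qed.

(** The [q]-th power of an error of order [N + 1] has order at least [q (N + 1)], hence at least
    [N + 2]. Nothing is gained from precision 0, so the hypothesis starts at [N.+1]. *)
Lemma approx_Frobenius q N f : (1 < q)%N ->
  (forall f g : L, (f - g) ^+ q = f ^+ q - g ^+ q) ->
  approx N.+1 f -> approx N.+2 (f ^+ q).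
Proof.
move=> q1 frobB [phi h]; exists (phi ^+ q).
rewrite rmorphXn horner_exp -frobB; apply: ord_ge_le (ord_geX q h).
by rewrite -PoszM lez_nat; nia.
Qed.

Definition approximable f := forall N, approx N f.

(** The order of a polynomial in [s] is that of its lowest term, a multiple of [k]. An approximant
    of precision beyond [P f] has the same order as [f]. *)
Lemma approximable_ord f : approximable f -> f != 0 -> (k %| P f)%Z.
Proof.
move=> af f0; have [phi] := af (absz (P f + 1)); set N := (_%:Z) => h.
have hN : P f + 1 <= N by rewrite /N; lia.
have : ord_eq P (P f) (ev phi).
  rewrite -(subKr f (ev phi)); apply: ord_eqD; first exact: ord_eq_ord.
  by rewrite ord_geN //; apply: ord_ge_le h.
case/andP=> phi0 /eqP<-; have [j ->] := ev_ord phi0; exact: dvdz_mulr.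
Qed.

(** Quotients of approximable elements form a field containing the constants, [x] and [y], hence all
    of [L]. So [k] divides every order, in particular the order 1. *)
Lemma approximable_uniformizer x y : generated_by iota x y ->
  approximable x -> approximable y -> k = 1.
Proof.
move=> gen ax ay.
pose S f := exists g h, [/\ approximable g, approximable h, h != 0 & f = g / h].
have aP g h : approximable g -> approximable h -> approximable (g * h).
  by move=> ag ah N; apply: approxM.
have : forall f, S f.
  apply: gen => [c|f f' [g [h [ag ah h0 ->]]] [g' [h' [ag' ah' h0' ->]]]
    |f f' [g [h [ag ah h0 ->]]] [g' [h' [ag' ah' h0' ->]]]
    |f [g [h [ag ah h0 ->]]]||].
  - exists (iota c), 1; split; rewrite ?oner_neq0 ?divr1 // => N;
      [exact: approx_const|exact: approx1].
  - exists (g * h' + g' * h), (h * h'); split; rewrite ?mulf_neq0 //; first 1 last.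
    + exact: aP.
    + by field; rewrite h0 h0'.
    + by move=> N; apply: approxD; apply: approxM.
  - exists (g * g'), (h * h'); split; rewrite ?mulf_neq0 //; [exact: aP|exact: aP|].
    by field; rewrite h0 h0'.
  - have [->|g0] := eqVneq g 0.
      exists 0, 1; rewrite !mul0r invr0 oner_neq0; split=> // N; last exact: approx1.
      by rewrite -(rmorph0 iota); apply: approx_const.
    by exists h, g; split; rewrite // invf_div.
  - by exists x, 1; rewrite oner_neq0 divr1; split=> // N; apply: approx1.
  - by exists y, 1; rewrite oner_neq0 divr1; split=> // N; apply: approx1.
have [t Pt] := ord_onto P; case/(_ t) => g [h [ag ah h0 et]].
have t0 : t != 0 by apply/eqP => t0; move: Pt; rewrite t0 ord_zero.
have g0 : g != 0 by apply: contraNneq t0 => g0; rewrite et g0 mul0r.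
have : (k %| P t)%Z.
  rewrite et ord_mul ?invr_eq0 // (ord_eqP (ord_eqV (ord_eq_ord P h0))).
  by rewrite rpredB ?approximable_ord.
by rewrite Pt dvdz1; lia.
Qed.
End Approximation.

(** * Derivations and the order of a differential *)

Section Derivation.
Variables (K L : fieldType) (iota : {rmorphism K -> L}) (d : L -> L).
Hypothesis der : derivation iota d.

Lemma derM f g : d (f * g) = f * d g + g * d f.
Proof. by case: der. Qed.

Lemma der1 : d 1 = 0.
Proof.
have := derM 1 1; rewrite !mulr1 mul1r => /eqP.
by rewrite -[X in X == _]addr0 (inj_eq (addrI _)) => /eqP.
Qed.

Lemma derD f g : d (f + g) = d f + d g.
Proof. by case: der => /(_ 1 f g) + _; rewrite rmorph1 !mul1r. Qed.

Lemma der0 : d 0 = 0.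
Proof. by rewrite -[0](mulr0 0) derM !mul0r addr0. Qed.

Lemma derN f : d (- f) = - d f.
Proof. by apply/eqP; rewrite -addr_eq0 -derD addNr der0. Qed.

Lemma derB f g : d (f - g) = d f - d g.
Proof. by rewrite derD derN. Qed.

Lemma der_const c : d (iota c) = 0.
Proof.
by case: der => /(_ c 1 0) + _; rewrite mulr1 der1 der0 !addr0 mulr0.
Qed.

Lemma derX f n : d (f ^+ n) = n%:R * f ^+ n.-1 * d f.
Proof.
elim: n => [|n IH]; first by rewrite expr0 der1 !mul0r.
rewrite exprS derM IH /= mulrA; case: n {IH} => [|n]; first by rewrite expr0; ring.
by rewrite -[n.+2]addn1 natrD /= exprS; ring.
Qed.

Lemma derV f : f != 0 -> d f^-1 = - d f / f ^+ 2.
Proof.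
move=> f0; have := derM f f^-1; rewrite divff // der1 => /eqP.
rewrite eq_sym addr_eq0 => /eqP h; apply: (mulfI f0); rewrite h.
by field.
Qed.

Lemma der_sum (I : Type) (r : seq I) (f : I -> L) :
  d (\sum_(i <- r) f i) = \sum_(i <- r) d (f i).
Proof. exact: (big_morph d derD der0). Qed.

Lemma der_eq0_generated x y : generated_by iota x y ->
  d x = 0 -> d y = 0 -> forall f, d f = 0.
Proof.
move=> gen dx dy; apply: gen => // [c|f g df dg|f g df dg|f df].
- exact: der_const.
- by rewrite derD df dg addr0.
- by rewrite derM df dg !mulr0 addr0.
- have [->|f0] := eqVneq f 0; first by rewrite invr0 der0.
  by rewrite derV // df oppr0 mul0r.
Qed.
End Derivation.

Section Frobenius.
Variables (R : comNzRingType) (p e : nat).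
Hypothesis charR : p \in [pchar R].

Lemma pchar_exprD (f g : R) : (f + g) ^+ (p ^ e) = f ^+ (p ^ e) + g ^+ (p ^ e).
Proof.
by apply: exprDn_pchar; rewrite pnatX (eq_pnat _ (pcharf_eq charR)) pnat_id ?(pcharf_prime charR).
Qed.

Lemma pchar_exprN (f : R) : (- f) ^+ (p ^ e) = - f ^+ (p ^ e).
Proof.
apply/eqP; rewrite -addr_eq0 -pchar_exprD addNr expr0n expn_eq0.
by rewrite (negbTE (lt0n_neq0 (prime_gt0 (pcharf_prime charR)))).
Qed.

Lemma pchar_exprB (f g : R) : (f - g) ^+ (p ^ e) = f ^+ (p ^ e) - g ^+ (p ^ e).
Proof. by rewrite pchar_exprD pchar_exprN. Qed.
End Frobenius.

(** * Expansions over the field of q-th powers *)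

Section FrobeniusSpan.
Variables (K L : fieldType) (iota : {rmorphism K -> L}) (p e q : nat).
Hypotheses (charL : p \in [pchar L]) (qE : q = (p ^ e)%N) (q_gt1 : (1 < q)%N).

Let frobD (f g : L) : (f + g) ^+ q = f ^+ q + g ^+ q.
Proof. by rewrite qE; exact: pchar_exprD. Qed.

Lemma natr_pchar_exp : q%:R = 0 :> L.
Proof.
have e0 : (0 < e)%N by move: q_gt1; rewrite qE; case: (e).
by rewrite qE natrX (pcharf0 charL) expr0n gtn_eqF.
Qed.

Lemma der_frob (d : L -> L) (f : L) : derivation iota d -> d (f ^+ q) = 0.
Proof. by move=> der; rewrite (derX der) natr_pchar_exp !mul0r. Qed.

(** The span of [1, u, ..., u^(q-1)] over the subfield L^q. It is a ring since [u^q] lies in L^q,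
    and derivations act on it termwise since they kill L^q. *)
Definition frob_span (u f : L) : Prop :=
  exists c : nat -> L, f = \sum_(i < q) c i ^+ q * u ^+ i.

Lemma frob_spanD u f g : frob_span u f -> frob_span u g -> frob_span u (f + g).
Proof.
move=> [c ->] [c' ->]; exists (fun i => c i + c' i).
by rewrite -big_split; apply: eq_bigr => i _; rewrite frobD mulrDl.
Qed.

Lemma frob_spanZ u a f : frob_span u f -> frob_span u (a ^+ q * f).
Proof.
move=> [c ->]; exists (fun i => a * c i).
by rewrite mulr_sumr; apply: eq_bigr => i _; rewrite exprMn mulrA.
Qed.

Lemma frob_span1 u : frob_span u 1.
Proof.
exists (fun i => (i == 0)%:R); case: q q_gt1 => // r _.
rewrite big_ord_recl /= expr1n mulr1 big1 ?addr0 // => i _.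
by rewrite expr0n mul0r.
Qed.

Lemma frob_span_frob u a : frob_span u (a ^+ q).
Proof. by rewrite -[_ ^+ _]mulr1; apply/frob_spanZ/frob_span1. Qed.

Lemma frob_span_mulX u f : frob_span u f -> frob_span u (u * f).
Proof.
move=> [c ->]; exists (fun i => if i is i'.+1 then c i' else c q.-1 * u).
rewrite -(big_mkord xpredT (fun i => c i ^+ q * u ^+ i)).
rewrite -(big_mkord xpredT (fun i : nat =>
  (if i is i'.+1 then c i' else c q.-1 * u) ^+ q * u ^+ i)).
have eu : u ^+ q = u * u ^+ q.-1 by rewrite -exprS prednK // ltnW.
have er : q = q.-1.+1 by rewrite prednK // ltnW.
rewrite [in index_iota _ q]er big_nat_recr // big_nat_recl //=.
rewrite expr0 mulr1 addrC mulrDr big_distrr; congr (_ + _).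
  by rewrite exprMn eu; ring.
by apply: eq_bigr => i _; rewrite /= exprS mulrCA.
Qed.

Lemma frob_span_param u : frob_span u u.
Proof. by rewrite -[X in frob_span _ X]mulr1; apply/frob_span_mulX/frob_span1. Qed.

Lemma frob_spanM u f g : frob_span u f -> frob_span u g -> frob_span u (f * g).
Proof.
move=> [c ->] sg; rewrite mulr_suml.
elim/big_rec: _ => [|i h _ sh].
  by have := frob_span_frob u 0; rewrite expr0n gtn_eqF // ltnW.
apply: frob_spanD => //; rewrite -mulrA; apply: frob_spanZ.
by elim: (nat_of_ord i) => [|j IH]; rewrite ?expr0 ?mul1r // exprS -mulrA; apply: frob_span_mulX.
Qed.

(** Inversion reduces to multiplication: [f^-1] is the [q]-th power of [f^-1] times [f^(q-1)]. *)
Lemma frob_spanV u f : frob_span u f -> frob_span u f^-1.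
Proof.
move=> sf; have [->|f0] := eqVneq f 0.
  by rewrite invr0; have := frob_span_frob u 0; rewrite expr0n gtn_eqF // ltnW.
have -> : f^-1 = f^-1 ^+ q * f ^+ q.-1.
  have [r ->] : exists r, q = r.+1 by exists q.-1; rewrite prednK // ltnW.
  by rewrite /= exprS -mulrA -exprMn mulVf // expr1n mulr1.
apply: frob_spanZ; elim: q.-1 => [|n IH]; first by rewrite expr0; apply: frob_span1.
by rewrite exprS; apply: frob_spanM.
Qed.

Lemma frob_span_generated u x y : (forall c : K, exists b, c = b ^+ q) ->
  generated_by iota x y -> frob_span u x -> frob_span u y ->
  forall f, frob_span u f.
Proof.
move=> rootK gen sx sy; apply: gen => //.
- by move=> c; have [b ->] := rootK c; rewrite rmorphXn; apply: frob_span_frob.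
- exact: frob_spanD.
- exact: frob_spanM.
- exact: frob_spanV.
Qed.

(* The terms of an expansion over [L^q] in powers of [u] have orders that are
   pairwise distinct modulo [q], so the smallest one dominates, both in the
   expansion of [t] and in the termwise derivative. *)
Lemma ord_derivation (P : place iota) (d : L -> L) (u t g : L) (n : int) :
  ord_eq P n u -> coprimez q n -> (forall f, frob_span u f) ->
  derivation iota d -> d g != 0 -> P t = 1 ->
  d t != 0 /\ ord_eq P (n - 1) (d u / d t).
Proof.
move=> un cqn span der dg Pt.
have u0 := ord_eq_neq0 un.
have expand (c : nat -> L) :
    u * d (\sum_(i < q) c i ^+ q * u ^+ i) =
    d u * \sum_(i < q) i%:R * (c i ^+ q * u ^+ i).
  rewrite (der_sum der) !mulr_sumr; apply: eq_bigr => i _.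
  rewrite (derM der) (der_frob _ der) mulr0 addr0 (derX der).
  by case: (nat_of_ord i) => [|j]; rewrite ?mul0r ?mulr0 //= exprS; ring.
have du0 : d u != 0.
  apply: contraNneq dg => du; have [c eg] := span g.
  have := expand c; rewrite -eg du mul0r => /eqP.
  by rewrite mulf_eq0 (negbTE u0) /= => /eqP->.
have [c et] := span t; pose T (i : 'I_q) := c i ^+ q * u ^+ i.
have t0 : t != 0 by apply/eqP => t0; move: Pt; rewrite t0 ord_zero.
have [i1 Ti1] : exists i, T i != 0.
  apply/existsP; apply: contraNT t0; rewrite negb_exists => /forallP h.
  by rewrite et big1 // => i _; apply/eqP; move: (h i); rewrite negbK.
have := @Order.TotalTheory.arg_minP _ _ _ i1 (fun i => T i != 0) (fun i => P (T i)) Ti1.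
case=> i Ti min_i.
have PT j : T j != 0 -> exists m : int, P (T j) = q%:Z * m + n * j%:Z.
  rewrite /T => Tj; exists (P (c j)); rewrite (mulrC q%:Z).
  apply/ord_eqP/ord_eqM; apply: ord_eqX => //; apply: ord_eq_ord.
  by apply: contraNneq Tj => ->; rewrite expr0n gtn_eqF ?mul0r ?eqxx // ltnW.
have rest j : j != i -> ord_ge P (P (T i) + 1) (T j).
  move=> ji; rewrite /ord_ge; case: eqP => //= /eqP Tj.
  rewrite lezD1 lt_neqAle min_i // andbT; apply: contraNneq ji => eP.
  have [m em] := PT _ Ti; have [m' em'] := PT _ Tj.
  have : (q%:Z %| n * (i%:Z - j%:Z))%Z.
    by apply/dvdzP; exists (m' - m); move: eP; rewrite em em'; lia.
  rewrite Gauss_dvdzr // => /dvdzP[r er].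
  have hi := ltn_ord i; have hj := ltn_ord j.
  have r0 : r = 0 by nia.
  by apply/eqP/val_inj => /=; move: er; rewrite r0; lia.
have PTi : P (T i) = 1.
  rewrite -Pt; apply/esym/ord_eqP; rewrite et (bigD1 i) //=.
  by apply: ord_eqD; [exact: ord_eq_ord|apply: ord_ge_sum => j; exact: rest].
(* The dominant index is prime to [p]: otherwise [p] would divide [P (T i) = q m + n i], which is 1.
   So this term survives differentiation. *)
have i0 : i%:R != 0 :> L.
  rewrite -(dvdn_pcharf charL); apply/negP => /dvdnP[k ek].
  have [m em] := PT _ Ti; have e0 : (0 < e)%N by move: q_gt1; rewrite qE; case: (e).
  have pp := prime_gt1 (pcharf_prime charL).
  have : (p%:Z %| P (T i))%Z.
    rewrite em; apply: rpredD; first apply: dvdz_mulr.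
      by rewrite qE -[e]prednK // expnS PoszM dvdz_mulr.
    by rewrite ek PoszM mulrA dvdz_mull.
  by rewrite PTi dvdz1 /=; lia.
pose s := \sum_(j < q) j%:R * T j.
have s1 : ord_eq P 1 s.
  rewrite /s (bigD1 i) //=; apply: ord_eqD.
    rewrite -[1]add0r; apply: ord_eqM; last by rewrite -PTi; apply: ord_eq_ord.
    have ik : i%:R != 0 :> K by apply: contraNneq i0 => h; rewrite -(rmorph_nat iota) h rmorph0.
    by rewrite -(rmorph_nat iota); apply: ord_eq_const.
  apply: ord_ge_sum => j /rest; rewrite PTi => h.
  by rewrite -[1 + 1]add0r; apply: ord_geM => //; apply: ord_ge_nat.
have eds : u * d t = d u * s by rewrite et expand.
have s0 := ord_eq_neq0 s1.
have dt0 : d t != 0.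
  apply: contraNneq du0 => h; move/eqP: eds.
  by rewrite h mulr0 eq_sym mulf_eq0 (negbTE s0) orbF.
split=> //; have -> : d u / d t = u / s by apply/eqP; rewrite eqr_div // -eds mulrC.
exact: ord_eq_div.
Qed.
End FrobeniusSpan.

(** * Affine charts of the curve *)

Section Chart.
Variables (K L : fieldType) (iota : {rmorphism K -> L}) (p e q : nat).
Hypotheses (charL : p \in [pchar L]) (qE : q = (p ^ e)%N) (q_gt2 : (2 < q)%N).

Let q_gt1 : (1 < q)%N. Proof. exact: ltnW. Qed.
Let q_gt0 : (0 < q)%N. Proof. exact: ltnW. Qed.

Lemma frobD k (f g : L) : (f + g) ^+ (q ^ k) = f ^+ (q ^ k) + g ^+ (q ^ k).
Proof. by rewrite qE -expnM pchar_exprD. Qed.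

Lemma frobB k (f g : L) : (f - g) ^+ (q ^ k) = f ^+ (q ^ k) - g ^+ (q ^ k).
Proof. by rewrite qE -expnM pchar_exprB. Qed.

Lemma frob1B (f g : L) : (f - g) ^+ q = f ^+ q - g ^+ q.
Proof. exact: (frobB 1). Qed.

Lemma frob2E (R : pzSemiRingType) (f : R) : f ^+ (q ^ 2) = f ^+ q ^+ q.
Proof. by rewrite -exprM mulnn. Qed.

Lemma frob3E (R : pzSemiRingType) (f : R) : f ^+ (q ^ 3) = f ^+ (q ^ 2) ^+ q.
Proof. by rewrite -exprM -expnSr. Qed.

(** The equation [D1(x, y, 1) = 0] after subtracting the first column from the others. In the same
    way [frob_det] is [D2(x, y, 1)]. *)
Definition frob_rel (x y : L) : Prop :=
  (x ^+ (q ^ 3) - x) * (y ^+ q - y) = (y ^+ (q ^ 3) - y) * (x ^+ q - x).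

Definition frob_det (x y : L) : L :=
  (x ^+ q - x) * (y ^+ (q ^ 2) - y) - (y ^+ q - y) * (x ^+ (q ^ 2) - x).

(** Linear independence of [1, x, y] over F_q, which rules out the components of [D1 = 0] that are
    lines over F_q. *)
Definition frob_indep (x y : L) : Prop :=
  forall c0 c1 c2 : K, c0 ^+ q = c0 -> c1 ^+ q = c1 -> c2 ^+ q = c2 ->
    iota c0 + iota c1 * x + iota c2 * y = 0 -> [/\ c0 = 0, c1 = 0 & c2 = 0].

(** All that the local study uses of the function field. It is stable under permuting the
    homogeneous coordinates, so one computation serves the three affine charts. *)
Definition chart (x y : L) : Prop :=
  [/\ frob_rel x y, frob_indep x y & generated_by iota x y].

Lemma frob_fixX (R : pzSemiRingType) (c : R) k : c ^+ q = c -> c ^+ (q ^ k) = c.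
Proof. by move=> cq; elim: k => [|k IH]; rewrite ?expr1 // expnSr exprM IH. Qed.

Lemma frob_shift (c g : K) k x y : c ^+ q = c -> g ^+ q = g ->
  (y - iota c * x - iota g) ^+ (q ^ k) - (y - iota c * x - iota g) =
  (y ^+ (q ^ k) - y) - iota c * (x ^+ (q ^ k) - x).
Proof.
move=> cq gq; rewrite !frobB exprMn -!rmorphXn.
by rewrite /= (frob_fixX k cq) (frob_fixX k gq); ring.
Qed.

Lemma frob_rel_sym x y : frob_rel x y -> frob_rel y x.
Proof. by rewrite /frob_rel => ->. Qed.

(** Subtracting [(x^q - x) (y^q - y)] from both sides turns the differences with [q^3] into [q]-th
    powers of [x^(q^2) - x] and [y^(q^2) - y]. In this form orders can be compared. *)
Lemma frob_rel_sub x y : frob_rel x y ->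
  (x ^+ (q ^ 3) - x ^+ q) * (y ^+ q - y) = (y ^+ (q ^ 3) - y ^+ q) * (x ^+ q - x).
Proof.
have subBB (a b c : L) : a - b = (a - c) - (b - c) by ring.
rewrite /frob_rel => h; rewrite (subBB _ (x ^+ q) x) (subBB _ (y ^+ q) y).
by rewrite mulrBl [RHS]mulrBl h; congr (_ - _); rewrite mulrC.
Qed.

Lemma frob_rel_shift (c g : K) x y : c ^+ q = c -> g ^+ q = g ->
  frob_rel x y -> frob_rel x (y - iota c * x - iota g).
Proof.
move=> cq gq h; have e1 := frob_shift 1 x y cq gq; have e3 := frob_shift 3 x y cq gq.
rewrite expn1 in e1; rewrite /frob_rel e1 e3 [LHS]mulrBr [RHS]mulrBl h.
by congr (_ - _); rewrite mulrCA mulrA.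
Qed.

Lemma frob_det_shift (c g : K) x y : c ^+ q = c -> g ^+ q = g ->
  frob_det x (y - iota c * x - iota g) = frob_det x y.
Proof.
move=> cq gq; have e1 := frob_shift 1 x y cq gq; have e2 := frob_shift 2 x y cq gq.
rewrite expn1 in e1; rewrite /frob_det e1 e2.
by ring.
Qed.

Lemma frob_sub31 (x : L) : x ^+ (q ^ 3) - x ^+ q = (x ^+ (q ^ 2) - x) ^+ q.
Proof. by rewrite frob1B frob3E. Qed.

Lemma frob_sub21 (x : L) : x ^+ (q ^ 2) - x ^+ q = (x ^+ q - x) ^+ q.
Proof. by rewrite frob1B frob2E. Qed.

Lemma frob_detE x y : frob_det x y =
  (x ^+ q - x) * (y ^+ q - y) ^+ q - (y ^+ q - y) * (x ^+ q - x) ^+ q.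
Proof. by rewrite -!frob_sub21 /frob_det; ring. Qed.

Lemma frob_indep_neq0 x y c g :
  frob_indep x y -> c ^+ q = c -> g ^+ q = g -> y - iota c * x - iota g != 0.
Proof.
move=> ind cq gq; apply/eqP => h.
have Nq (a : K) : a ^+ q = a -> (- a) ^+ q = - a.
  by move=> aq; apply: (fmorph_inj iota); rewrite rmorphXn !rmorphN -[- iota a]sub0r
    frob1B expr0n gtn_eqF // -rmorphXn aq.
have [|_ _ /eqP] := ind (- g) (- c) 1 (Nq _ gq) (Nq _ cq) (expr1n _ _).
  by rewrite -h !rmorphN rmorph1; ring.
by rewrite oner_eq0.
Qed.

(** * Orders and residues of Frobenius differences at a place *)

Section Place.
Variable P : place iota.

Lemma frob_sub_param u n k : (0 < k)%N -> 0 < n -> ord_eq P n u ->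
  ord_eq P n (u ^+ (q ^ k) - u).
Proof.
move=> k0 n0 un; apply: ord_eqDr; last by rewrite ord_eqN.
apply: ord_ge_le (ord_geX _ (ord_eq_ge un)).
have : (1 < q ^ k)%N by rewrite -[1%N](exp1n k) ltn_exp2r.
by move: (q ^ k)%N => Q hQ; nia.
Qed.

Lemma frob_sub_ge1 u k : (0 < k)%N -> ord_ge P 1 u -> ord_ge P 1 (u ^+ (q ^ k) - u).
Proof.
move=> k0 u1; apply: ord_geB => //; apply: ord_ge_le (ord_geX _ u1).
by rewrite mul1r lez_nat expn_gt0 q_gt0.
Qed.

Lemma frob_sub_residue (x : L) a k : x ^+ (q ^ k) - x =
  ((x - iota a) ^+ (q ^ k) - (x - iota a)) + iota (a ^+ (q ^ k) - a).
Proof. by rewrite frobB rmorphB rmorphXn /=; ring. Qed.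

Lemma frob_sub_unit x a k : (0 < k)%N -> ord_ge P 1 (x - iota a) ->
  a ^+ (q ^ k) != a -> ord_eq P 0 (x ^+ (q ^ k) - x).
Proof.
move=> k0 xa ak; rewrite (frob_sub_residue x a); apply: ord_eqDr.
  exact: frob_sub_ge1.
by apply: ord_eq_const; rewrite subr_eq0.
Qed.

Lemma frob_sub_fix x a n k : (0 < k)%N -> 0 < n -> ord_eq P n (x - iota a) ->
  a ^+ (q ^ k) = a -> ord_eq P n (x ^+ (q ^ k) - x).
Proof.
move=> k0 n0 xa ak; rewrite (frob_sub_residue x a) ak subrr rmorph0 addr0.
exact: frob_sub_param.
Qed.

Lemma frob_sub_fix_ge1 x a k : (0 < k)%N -> ord_ge P 1 (x - iota a) ->
  a ^+ (q ^ k) = a -> ord_ge P 1 (x ^+ (q ^ k) - x).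
Proof.
move=> k0 xa ak; rewrite (frob_sub_residue x a) ak subrr rmorph0 addr0.
exact: frob_sub_ge1.
Qed.

Lemma frob_sub_fixP x a k : (0 < k)%N -> ord_ge P 1 (x - iota a) ->
  ord_ge P 1 (x ^+ (q ^ k) - x) -> a ^+ (q ^ k) = a.
Proof.
move=> k0 xa x1; apply/eqP/negPn/negP => /(frob_sub_unit k0 xa) /ord_eq_lt/(_ x1).
by [].
Qed.

(** Meant for a line [w] over F_q through the center. For [m = 0] the equation has no solution
    [l > 0]; for [m > 0] it makes [m] and [l] proportional to [q - 1] and [q]. *)
Lemma frob_rel_ord x w m l : frob_rel x w -> 0 < l -> ord_eq P 0 (x ^+ q - x) ->
  ord_eq P m (x ^+ (q ^ 2) - x) -> ord_eq P l w -> m * q%:Z + l = l * q%:Z.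
Proof.
move=> /frob_rel_sub; rewrite !frob_sub31 => h l0 x1 xm wl.
have w1 : ord_eq P l (w ^+ q - w) by have := frob_sub_param (ltn0Sn 0) l0 wl; rewrite expn1.
have w2 := frob_sub_param (ltn0Sn 1) l0 wl.
have := ord_eqM (ord_eqX q xm) w1; rewrite h => /ord_eqP <-.
by rewrite (ord_eqP (ord_eqM (ord_eqX q w2) x1)) addr0.
Qed.

Lemma frob_rel_ord_eq u v m l : frob_rel u v -> 0 < m -> 0 < l ->
  ord_eq P m u -> ord_eq P l v -> m = l.
Proof.
move=> /frob_rel_sub; rewrite !frob_sub31 => h m0 l0 um vl.
have u1 : ord_eq P m (u ^+ q - u) by have := frob_sub_param (ltn0Sn 0) m0 um; rewrite expn1.
have v1 : ord_eq P l (v ^+ q - v) by have := frob_sub_param (ltn0Sn 0) l0 vl; rewrite expn1.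
have u2 := frob_sub_param (ltn0Sn 1) m0 um.
have v2 := frob_sub_param (ltn0Sn 1) l0 vl.
have := ord_eqM (ord_eqX q u2) v1; rewrite h => /ord_eqP.
by rewrite (ord_eqP (ord_eqM (ord_eqX q v2) u1)) => hh; nia.
Qed.

Hypothesis frob_split : exists r : seq K, all (fun c => c ^+ q == c) r /\
  forall f : L, f ^+ q - f = \prod_(c <- r) (f - iota c).

(** The residue is sought among the roots of [T^q - T] only: if no factor [f - c] vanished at [P],
    their product [f^q - f] would be a unit. *)
Lemma frob_residue f : ord_ge P 0 f -> ord_ge P 1 (f ^+ q - f) ->
  exists2 c, c ^+ q = c & ord_ge P 1 (f - iota c).
Proof.
case: frob_split => r [rq ->] f0 prod1.
have [/hasP[c cr fc]|] := boolP (has (fun c => ord_ge P 1 (f - iota c)) r).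
  by exists c => //; apply/eqP/(allP rq).
rewrite -all_predC => /allP h; move: prod1; have : ord_eq P 0 (\prod_(c <- r) (f - iota c)).
  rewrite big_seq; elim/big_rec: _ => [|c g cr g0]; first exact: ord_eq1.
  rewrite -[0]addr0; apply: ord_eqM => //; apply: ord_ge0_eq0 (h c cr).
  by apply: ord_geB => //; apply: ord_ge_const.
by move=> /ord_eq_lt/[apply].
Qed.

Lemma frob_fixP f : f ^+ q = f -> exists2 c, c ^+ q = c & f = iota c.
Proof.
case: frob_split => r [rq h] fq; move: (h f); rewrite fq subrr.
move/esym/eqP; rewrite prodf_seq_eq0 => /hasP[c cr /= fc].
exists c; first exact/eqP/(allP rq).
by apply/eqP; rewrite -subr_eq0.
Qed.

(** With [s = (y^q - y) / (x^q - x)], the determinant is [(s^q - s) (x^q - x)^(q+1)]. If it vanishes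
    at [P], then [s] has a residue [c] in F_q, and [y - c x] has one too: the center lies on a line
    over F_q. *)
Lemma frob_det_residue x y : ord_ge P 0 x -> ord_ge P 0 y ->
  ord_eq P 0 (x ^+ q - x) -> ord_ge P 1 (frob_det x y) ->
  exists c g, [/\ c ^+ q = c, g ^+ q = g & ord_ge P 1 (y - iota c * x - iota g)].
Proof.
move=> x0 y0 x1 det1; have xn := ord_eq_neq0 x1.
pose s := (y ^+ q - y) / (x ^+ q - x).
have y1 : ord_ge P 0 (y ^+ q - y).
  by apply: ord_geB => //; rewrite -[0](mul0r q%:Z) ord_geX.
have s0 : ord_ge P 0 s by rewrite -[0]addr0 ord_geM //; apply/ord_eq_ge/ord_eqV0.
have ss : s ^+ q - s = frob_det x y / (x ^+ q - x) ^+ q.+1.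
  rewrite frob_detE /s expr_div_n exprS; set X := x ^+ q - x; set Y := y ^+ q - y.
  by field; rewrite expf_neq0.
have s1 : ord_ge P 1 (s ^+ q - s).
  rewrite ss -[1]addr0 ord_geM //; apply/ord_eq_ge/ord_eqV0.
  by rewrite -[0](mul0r (q.+1)%:Z) ord_eqX.
have [c cq sc] := frob_residue s0 s1.
pose z := y - iota c * x.
have z0 : ord_ge P 0 z by rewrite ord_geB // -[0]addr0 ord_geM // ord_ge_const.
have z1 : ord_ge P 1 (z ^+ q - z).
  have -> : z ^+ q - z = (s - iota c) * (x ^+ q - x).
    rewrite mulrBl divfK // /z frob1B exprMn -rmorphXn /= cq.
    by ring.
  by rewrite -[1]addr0 ord_geM //; apply: ord_eq_ge.
have [g gq zg] := frob_residue z0 z1.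
by exists c, g.
Qed.

(** At a point over F_q the relation gives every line [y - c x - g] over F_q through it the order of
    [u]. It also makes [s = v / u] congruent to [s^q], so [s] has a residue [c] in F_q, and
    [v - c u] is such a line of larger order. *)
Lemma no_frob_fixed_center x y a b : frob_rel x y -> frob_indep x y ->
  ord_ge P 1 (x - iota a) -> ord_ge P 1 (y - iota b) ->
  a ^+ q = a -> b ^+ q = b -> False.
Proof.
move=> rel ind xa yb aq bq.
have q00 : 0 ^+ q = 0 :> K by rewrite expr0n gtn_eqF.
have rel_u w : frob_rel x w -> frob_rel (x - iota a) w.
  move/frob_rel_sym/(frob_rel_shift q00 aq)/frob_rel_sym.
  by rewrite rmorph0 mul0r subr0.
set u := x - iota a in xa rel_u.
have u0 : u != 0.
  apply/eqP => /eqP; rewrite subr_eq0 => /eqP xE.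
  have [] := ind a (-1) 0 aq _ q00.
  - apply: (fmorph_inj iota); rewrite rmorphXn rmorphN1 -[-1]sub0r frob1B.
    by rewrite expr0n gtn_eqF // expr1n.
  - by rewrite xE rmorphN1 rmorph0; ring.
  - by move=> _ /eqP; rewrite oppr_eq0 oner_eq0.
have key c g : c ^+ q = c -> g ^+ q = g ->
    ord_ge P 1 (y - iota c * x - iota g) -> P (y - iota c * x - iota g) = P u.
  move=> cq gq w1; have w0 := frob_indep_neq0 ind cq gq.
  have relw := rel_u _ (frob_rel_shift cq gq rel).
  apply/esym/(frob_rel_ord_eq relw); last 2 first.
  - exact: ord_eq_ord.
  - exact: ord_eq_ord.
  - by move: xa; rewrite /ord_ge (negbTE u0).
  - by move: w1; rewrite /ord_ge (negbTE w0).
pose v := y - iota b.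
have vE : y - iota 0 * x - iota b = v by rewrite rmorph0 mul0r subr0.
have v0 : v != 0 by rewrite -vE; apply: frob_indep_neq0.
have Pv : P v = P u by rewrite -vE; apply: key; rewrite ?vE.
have um := ord_eq_ord P u0; have vm := ord_eq_ord P v0; rewrite Pv in vm.
set m := P u in um vm; have m1 : 1 <= m by move: xa; rewrite /ord_ge (negbTE u0).
pose s := v / u.
have s0 : ord_eq P 0 s by rewrite -(subrr m); apply: ord_eq_div.
have relv : frob_rel u v by rewrite -vE; apply/rel_u/frob_rel_shift.
have vsu : v = s * u by rewrite divfK.
have factor (f g : L) : (f ^+ (q ^ 3) - f ^+ q) * (g ^+ q - g) =
    (f ^+ (q ^ 2).-1 - 1) ^+ q * (g ^+ q.-1 - 1) * (f ^+ q * g).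
  rewrite frob_sub31; have -> : f ^+ (q ^ 2) - f = (f ^+ (q ^ 2).-1 - 1) * f.
    by rewrite mulrBl mul1r -exprSr prednK // expn_gt0 q_gt0.
  have -> : g ^+ q - g = (g ^+ q.-1 - 1) * g.
    by rewrite mulrBl mul1r -exprSr prednK.
  by rewrite exprMn; ring.
(* [A u v] and [A v u] remain of the two sides once [u^q v] and [v^q u] are split off. Both are
   congruent to [(-1)^q (-1) = 1] at [P]. *)
pose A f g := (f ^+ (q ^ 2).-1 - 1) ^+ q * (g ^+ q.-1 - 1) : L.
have A1 f g : ord_ge P 1 f -> ord_ge P 1 g -> ord_ge P 1 (A f g - 1).
  move=> f1 g1.
  have gt0X (h : L) n : (0 < n)%N -> ord_ge P 1 h -> ord_ge P 1 (h ^+ n).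
    by move=> n0 h1; apply: ord_ge_le (ord_geX n h1); rewrite mul1r lez_nat.
  have -> : A f g - 1 = (f ^+ (q ^ 2).-1) ^+ q * (g ^+ q.-1 - 1) - g ^+ q.-1.
    by rewrite /A frob1B expr1n; ring.
  have q1 : (0 < q.-1)%N by rewrite -subn1 subn_gt0.
  have q21 : (0 < (q ^ 2).-1)%N.
    by rewrite -subn1 subn_gt0 (leq_trans q_gt1) // -{1}[q]expn1 leq_pexp2l.
  apply: ord_geB; last exact: gt0X.
  rewrite -[1]addr0; apply: ord_geM; first by apply/gt0X/gt0X.
  by apply: ord_geB (ord_ge1 P); apply/ord_gtW/gt0X.
have v1 : ord_ge P 1 v by apply: ord_ge_le (ord_eq_ge vm).
have sA : s ^+ q * A v u = s * A u v.
  have uq : u ^+ q * u != 0 by rewrite mulf_neq0 // expf_neq0.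
  apply: (mulIf uq); have := frob_rel_sub relv; rewrite !factor -/(A u v) -/(A v u).
  rewrite {2 4}vsu exprMn => h.
  by transitivity (A v u * (s ^+ q * u ^+ q * u)); [|rewrite -h]; ring.
have s1 : ord_ge P 1 (s ^+ q - s).
  have -> : s ^+ q - s = s * (A u v - 1) - s ^+ q * (A v u - 1).
    by rewrite [s ^+ q * _]mulrBr sA; ring.
  have sg := ord_eq_ge s0.
  apply: ord_geB; rewrite -[1]add0r; apply: ord_geM => //; [exact: A1| |exact: A1].
  by rewrite -[0](mul0r q%:Z); apply: ord_geX.
have [c cq sc] := frob_residue (ord_eq_ge s0) s1.
have gq : (b - c * a) ^+ q = b - c * a.
  by apply: (fmorph_inj iota); rewrite rmorphXn rmorphB frob1B -!rmorphXn exprMn aq bq cq.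
have wE : y - iota c * x - iota (b - c * a) = (s - iota c) * u.
  by rewrite mulrBl -vsu /u /v rmorphB rmorphM /=; ring.
have w1 : ord_ge P (m + 1) (y - iota c * x - iota (b - c * a)).
  by rewrite wE addrC; apply: ord_geM => //; apply: ord_eq_ge.
have w1' : ord_ge P 1 (y - iota c * x - iota (b - c * a)).
  by apply: ord_ge_le w1; rewrite ler_wpDl // (le_trans _ m1).
have := key _ _ cq gq w1'; move: w1; rewrite /ord_ge.
rewrite (negbTE (frob_indep_neq0 ind cq gq)) /= => h1 h2; move: h1.
by rewrite h2 -/m gerDl.
Qed.

Hypothesis K_root : forall c : K, exists b, c = b ^+ q.

(** [W_R dx^(q+1)] in closed form, where [dx] stands for the derivative of [x] by a local parameter.
    The product is kept together because between charts it changes only by a sign and a cube. *)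
Definition wronskian (x y dx : L) : L :=
  frob_det x y * ((x ^+ (q ^ 3) - x) / (x ^+ (q ^ 3) - x ^+ q))
  * (dx / (x ^+ q - x)) ^+ q.+1.

(** The tangent line solved for [y]. As its coefficients are [q]-th powers, [y] lies in the span of
    [1] and [x] over L^q. *)
Lemma frob_rel_solve x y : frob_rel x y -> x ^+ (q ^ 2) != x ->
  y = ((y - y ^+ (q ^ 2)) / (x - x ^+ (q ^ 2))) ^+ q * x
      + ((x * y ^+ (q ^ 2) - x ^+ (q ^ 2) * y) / (x - x ^+ (q ^ 2))) ^+ q.
Proof.
move=> rel; rewrite eq_sym -subr_eq0 => x2.
rewrite !expr_div_n; have x20 := expf_neq0 q x2.
apply: (mulIf x20); rewrite mulrDl mulrAC divfK // divfK //.
rewrite !frob1B !exprMn -!frob3E.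
apply/eqP; rewrite -subr_eq0; apply/eqP.
move: rel; rewrite /frob_rel => rel.
transitivity ((x ^+ (q ^ 3) - x) * (y ^+ q - y) - (y ^+ (q ^ 3) - y) * (x ^+ q - x)).
  by ring.
by rewrite rel subrr.
Qed.

Lemma frob_span_chart x y a : frob_rel x y -> generated_by iota x y ->
  x ^+ (q ^ 2) != x -> forall f, frob_span q (x - iota a) f.
Proof.
move=> rel gen x2; have span := frob_span_generated charL qE q_gt1 K_root gen.
have sx : frob_span q (x - iota a) x.
  rewrite -{2}(subrK (iota a) x); apply: (frob_spanD charL qE).
    exact: frob_span_param.
  by have [b ->] := K_root a; rewrite rmorphXn; apply: frob_span_frob.
apply: span => //; rewrite (frob_rel_solve rel x2).
apply: (frob_spanD charL qE); first exact: frob_spanZ.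
exact: frob_span_frob.
Qed.

(** * The order of the Wronskian in one chart *)

Section Derivation.
Variables (d : L -> L) (g : L).
Hypotheses (der : derivation iota d) (dg : d g != 0).

Lemma der_frobk f k : d (f ^+ (q ^ k.+1)) = 0.
Proof. by rewrite expnSr exprM (der_frob charL qE q_gt1 _ der). Qed.

Lemma der_frob1 f : d (f ^+ q) = 0. Proof. exact: (der_frobk f 0). Qed.

Lemma der_frob_rel x y : frob_rel x y ->
  d x * (y ^+ (q ^ 3) - y ^+ q) = d y * (x ^+ (q ^ 3) - x ^+ q).
Proof.
move=> /(congr1 d); rewrite !(derM der) !(derB der) !der_frobk !der_frob1 => h.
apply/eqP; rewrite -subr_eq0; apply/eqP.
rewrite !sub0r in h; move/eqP: h; rewrite -subr_eq0 => /eqP h.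
by rewrite -[RHS]h; ring.
Qed.

Lemma chart_neq x y : frob_indep x y -> x ^+ q != x /\ y ^+ q != y.
Proof.
move=> ind; have q00 : 0 ^+ q = 0 :> K by rewrite expr0n gtn_eqF.
have Nq (c : K) : c ^+ q = c -> (- c) ^+ q = - c.
  by move=> cq; apply: (fmorph_inj iota); rewrite rmorphXn !rmorphN -[- iota c]sub0r
    frob1B expr0n gtn_eqF // -rmorphXn cq.
split; apply/eqP => /frob_fixP[c cq E].
- have [|_ /eqP] := ind (- c) 1 0 (Nq _ cq) (expr1n _ _) q00.
    by rewrite E rmorphN rmorph1 rmorph0; ring.
  by rewrite oner_eq0.
have [|_ _ /eqP] := ind (- c) 0 1 (Nq _ cq) q00 (expr1n _ _).
  by rewrite E rmorphN rmorph1 rmorph0; ring.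
by rewrite oner_eq0.
Qed.

(** If [d x = 0], the differentiated relation gives [d y = 0] unless [x^(q^3) = x^q]. In that case
    the relation itself gives [y = y^(q^2)], which [d] kills. But a derivation that is zero on both
    generators is zero. *)
Lemma chart_der x y : chart x y -> d x != 0.
Proof.
move=> [rel ind gen]; have [x1 _] := chart_neq ind.
apply: contraNneq dg => dx; apply/eqP; apply: (der_eq0_generated der gen) => //.
have := der_frob_rel rel; rewrite dx mul0r => /esym/eqP.
rewrite mulf_eq0 => /orP[/eqP //|/eqP x31].
have := frob_rel_sub rel; rewrite x31 mul0r => /esym/eqP.
rewrite mulf_eq0 [_ - x == 0]subr_eq0 (negbTE x1) orbF frob_sub31 expf_eq0 => /andP[_].
rewrite subr_eq0 => /eqP y2.
by rewrite -y2 der_frobk.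
Qed.

Lemma chart_frob_neq x y k : chart x y -> x ^+ (q ^ k.+1) != x.
Proof.
move=> /chart_der; apply: contraNneq => h; apply/eqP.
by rewrite -h der_frobk.
Qed.

Lemma wronskian_nonsingular x y a b t : chart x y ->
  ord_ge P 1 (x - iota a) -> ord_ge P 1 (y - iota b) ->
  a ^+ (q ^ 2) != a -> P t = 1 ->
  d t != 0 /\
  ord_eq P (if a ^+ (q ^ 3) == a then 1 else 0) (wronskian x y (d x / d t)).
Proof.
move=> ch xa yb a2 Pt; have [rel ind gen] := ch.
have aq : a ^+ (q ^ 1) != a by apply: contra a2 => /eqP aq; apply/eqP/frob_fixX.
have x1 : ord_eq P 0 (x ^+ q - x) by have := frob_sub_unit (ltn0Sn 0) xa aq; rewrite expn1.
have x2 : ord_eq P 0 (x ^+ (q ^ 2) - x) by apply: frob_sub_unit xa a2.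
have x31 : ord_eq P 0 (x ^+ (q ^ 3) - x ^+ q).
  by rewrite frob_sub31 -[0](mul0r q%:Z) ord_eqX.
have x2n : x ^+ (q ^ 2) != x by rewrite -subr_eq0 (ord_eq_neq0 x2).
have reg f c : ord_ge P 1 (f - iota c) -> ord_ge P 0 f.
  by move=> fc; rewrite -(subrK (iota c) f) ord_geD ?ord_ge_const ?ord_gtW.
have du : d (x - iota a) = d x by rewrite (derB der) (der_const der) subr0.
have u0 : x - iota a != 0.
  by apply: contraNneq (chart_der ch) => h; rewrite -du h (der0 der).
have uE := ord_eq_ord P u0; set n := P (x - iota a) in uE.
have n0 : 0 < n by have := xa; rewrite /ord_ge (negbTE u0).
have appx : approximable P (x - iota a) x.
  move=> N; rewrite -{2}(subrK (iota a) x); apply: approxD.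
    exact: approx_param.
  exact: approx_const.
have appy : approximable P (x - iota a) y.
  (* On the right [y] occurs only through [y^q] and [y^(q^3)], and the denominator is a unit, so
     each substitution raises the precision of [y] by one. *)
  have yE : y = (x * (y ^+ q - y ^+ (q ^ 3)) + (x ^+ q * y ^+ (q ^ 3) - x ^+ (q ^ 3) * y ^+ q))
                / (- (x ^+ (q ^ 3) - x ^+ q)).
    apply: (mulIf (_ : - (x ^+ (q ^ 3) - x ^+ q) != 0)).
      by rewrite oppr_eq0 (ord_eq_neq0 x31).
    rewrite divfK ?oppr_eq0 ?(ord_eq_neq0 x31) //.
    apply/eqP; rewrite -subr_eq0; apply/eqP.
    move: rel; rewrite /frob_rel => rel.
    transitivity ((x ^+ (q ^ 3) - x) * (y ^+ q - y) - (y ^+ (q ^ 3) - y) * (x ^+ q - x)).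
      by ring.
    by rewrite rel subrr.
  have step N : approx P (x - iota a) N.+1 y -> approx P (x - iota a) N.+2 y.
    move=> /(approx_Frobenius n0 uE q_gt1 frob1B) y1.
    have y3 : approx P (x - iota a) N.+2 (y ^+ (q ^ 3)).
      by rewrite expnS exprM; apply: (approxX n0 uE).
    have [aX aM aB] := And3 (approxX n0 uE) (approxM n0 uE) (approxB n0 uE).
    rewrite yE; apply: (approx_div n0 uE).
    - apply: approxD; first exact/aM/aB.
      by apply: aB; apply: aM => //; apply: aX.
    - by rewrite ord_eqN.
    - by apply: (approxN n0 uE); apply: aB; apply: aX.
  have base : approx P (x - iota a) 1 y.
    rewrite -(subrK (iota b) y); apply: approxD; first exact: approx_ge.
    exact: approx_const.
  case=> [|N]; first exact/approx_ge/(reg _ _ yb).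
  by elim: N => [//|N]; apply: step.
have n1 := approximable_uniformizer n0 uE gen appx appy.
rewrite n1 in uE.
have cq1 : coprimez q 1 by rewrite coprimezE coprimen1.
have [dt0 dut] := ord_derivation charL qE q_gt1 uE cq1
  (frob_span_chart a rel gen x2n) der dg Pt.
rewrite du subrr in dut; split=> //.
(* If [D2] vanished at [P], a line over F_q would pass through the center, and its order [l > 0]
   would satisfy [l = l q]. *)
have det0 : ord_eq P 0 (frob_det x y).
  apply: ord_ge0_eq0.
    have f0 f k : ord_ge P 0 f -> ord_ge P 0 (f ^+ (q ^ k) - f).
      by move=> h; apply: ord_geB => //; rewrite -[0](mul0r (q ^ k)%:Z) ord_geX.
    rewrite /frob_det; apply: ord_geB; rewrite -[0]addr0 ord_geM //.
    + exact: ord_eq_ge.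
    + exact/f0/(reg _ _ yb).
    + by have := f0 y 1%N (reg _ _ yb); rewrite expn1.
    + exact: ord_eq_ge.
  apply/negP => /(frob_det_residue (reg _ _ xa) (reg _ _ yb) x1)[c [r [cq rq w1]]].
  have w0 := frob_indep_neq0 ind cq rq.
  have wl := ord_eq_ord P w0; set l := P _ in wl.
  have l0 : 0 < l by move: w1; rewrite /ord_ge (negbTE w0).
  have arith (i : int) : 0 < i -> 0 * q%:Z + i <> i * q%:Z by clear -q_gt2; nia.
  exact: arith l0 (frob_rel_ord (frob_rel_shift cq rq rel) l0 x1 x2 wl).
have x3 : ord_eq P (if a ^+ (q ^ 3) == a then 1 else 0) (x ^+ (q ^ 3) - x).
  case: eqP => [a3|/eqP a3]; last exact: frob_sub_unit xa a3.
  exact: frob_sub_fix uE a3.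
move: (if _ then _ else _) x3 => r x3.
rewrite /wronskian -[r]addr0 -[r]add0r -{1}[r]subr0.
apply: ord_eqM; first by apply: ord_eqM => //; apply: ord_eq_div.
by rewrite -[0](mul0r q.+1%:Z) ord_eqX // -[0]subr0 ord_eq_div.
Qed.

(** In [u_s] the cofactor of [s] still contains [x] and [w], hence [u]. Precision [N] of [u] carries
    over to the cofactor, and the factor [s] split off from [s^(q-1)] raises it to [N + 1]. Once
    [l - m = 1], the linear relation determines [m] and [l]. *)
Lemma singular_uniformizer x w a u m l : u = x - iota a -> a ^+ (q ^ 2) = a ->
  frob_rel x w ->
  ord_eq P 0 (x ^+ q - x) -> ord_eq P m u -> ord_eq P l w -> 0 < m ->
  m * q%:Z + l = l * q%:Z -> generated_by iota x w ->
  m = q%:Z - 1 /\ l = q%:Z.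
Proof.
move=> uE a2 rel x1 um wl m0 ml gen.
have u0 := ord_eq_neq0 um.
have [k k0 kE] : exists2 k, 0 < k & k = l - m.
  by exists (l - m) => //; clear -ml m0 q_gt2; nia.
pose s := w / u.
have sk : ord_eq P k s by rewrite kE; apply: ord_eq_div.
have wE : w = s * u by rewrite divfK.
have l0 : 0 < l by clear -ml m0 k0 kE; lia.
have u1 : ord_ge P 1 u by apply: ord_ge_le (ord_eq_ge um).
have w1 : ord_ge P 1 w by apply: ord_ge_le (ord_eq_ge wl).
have unit1 f n : (0 < n)%N -> ord_ge P 1 f -> ord_eq P 0 (f ^+ n - 1).
  move=> n0 f1; apply: ord_eqDr; last by rewrite ord_eqN ord_eq1.
  by apply: ord_ge_le (ord_geX n f1); rewrite mul1r lez_nat.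
have q1 : (0 < q.-1)%N by rewrite -subn1 subn_gt0.
have q21 : (0 < (q ^ 2).-1)%N.
  by rewrite -subn1 subn_gt0 (leq_trans q_gt1) // -{1}[q]expn1 leq_pexp2l.
have factor f n : (0 < n)%N -> f ^+ n - f = (f ^+ n.-1 - 1) * f :> L.
  by move=> n0; rewrite mulrBl mul1r -exprSr prednK.
have s0 := ord_eq_neq0 sk.
pose X := x ^+ q - x; pose al := u ^+ (q ^ 2).-1 - 1.
pose be := w ^+ q.-1 - 1; pose ga := w ^+ (q ^ 2).-1 - 1.
have al0 : ord_eq P 0 (al ^+ q) by rewrite -[0](mul0r q%:Z); apply/ord_eqX/unit1.
have be0 : ord_eq P 0 be by apply: unit1.
have den0 : ord_eq P 0 (al ^+ q * be) by rewrite -[0]addr0; apply: ord_eqM.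
have u_s : u = s * (s ^+ (q - 2) * ga ^+ q * X / (al ^+ q * be)).
  have := frob_rel_sub rel; rewrite !frob_sub31 (frob_sub_residue x a) -uE.
  rewrite a2 subrr rmorph0 addr0 (factor u) ?expn_gt0 ?q_gt0 //.
  rewrite (factor w) // (factor w) ?expn_gt0 ?q_gt0 // -/X -/al -/be -/ga => h.
  rewrite !exprMn in h.
  apply: (mulIf (ord_eq_neq0 den0)); rewrite -[RHS]mulrA divfK ?(ord_eq_neq0 den0) //.
  have suq : s * u ^+ q != 0 by rewrite mulf_neq0 ?expf_neq0.
  apply: (mulIf suq).
  transitivity (al ^+ q * u ^+ q * (be * w)); first by rewrite wE; ring.
  rewrite h wE [(s * u) ^+ q]exprMn; have -> : s ^+ q = s * s * s ^+ (q - 2).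
    by rewrite -mulrA -!exprS; congr (_ ^+ _); clear -q_gt2; lia.
  by ring.
have appx N : approx P s N u -> approx P s N x.
  move=> h; rewrite -(subrK (iota a) x) -uE; apply: approxD => //; exact: approx_const.
have [aX aM aB] := And3 (approxX k0 sk) (approxM k0 sk) (approxB k0 sk).
have appw N : approx P s N u -> approx P s N w.
  by move=> h; rewrite wE; apply: aM => //; apply: approx_param.
have appu : approximable P s u.
  elim=> [|N IH]; first exact/approx_ge/ord_gtW.
  rewrite u_s; apply: (approx_param_gain k0 sk); apply: (approx_div k0 sk) => //.
    apply: (aM); [apply: (aM)|apply: (aB); [apply: (aX)|]; exact: appx].
      by apply: (aX); apply: approx_param.
    by apply: (aX); apply: (aB); [apply: (aX); apply: appw|apply: approx1].
  apply: (aM); first by apply: (aX); apply: (aB); [apply: (aX)|apply: approx1].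
  by apply: (aB); [apply: (aX); apply: appw|apply: approx1].
have k1 := approximable_uniformizer k0 sk gen (fun N => appx N (appu N)) (fun N => appw N (appu N)).
by clear -k1 kE ml m0 q_gt2; split; nia.
Qed.

Lemma wronskian_singular x y a b t : chart x y ->
  ord_ge P 1 (x - iota a) -> ord_ge P 1 (y - iota b) ->
  a ^+ (q ^ 2) = a -> b ^+ (q ^ 2) = b -> a ^+ q != a -> P t = 1 ->
  d t != 0 /\ ord_eq P (q%:Z - 2) (wronskian x y (d x / d t)).
Proof.
move=> ch xa yb a2 b2 a1 Pt; have [rel ind gen] := ch.
have x1 : ord_eq P 0 (x ^+ q - x).
  by have := @frob_sub_unit x a 1 isT xa; rewrite expn1; apply.
have reg f c : ord_ge P 1 (f - iota c) -> ord_ge P 0 f.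
  by move=> fc; rewrite -(subrK (iota c) f) ord_geD ?ord_ge_const ?ord_gtW.
have det1 : ord_ge P 1 (frob_det x y).
  have f1 f c : ord_ge P 1 (f - iota c) -> ord_ge P 0 (f ^+ q - f).
    by move=> /reg h; apply: ord_geB => //; rewrite -[0](mul0r q%:Z) ord_geX.
  rewrite /frob_det; apply: ord_geB; rewrite -[1]add0r ord_geM //.
  + exact: f1 xa.
  + exact: frob_sub_fix_ge1 yb b2.
  + exact: f1 yb.
  + exact: frob_sub_fix_ge1 xa a2.
have [c [r [cq rq w1]]] := frob_det_residue (reg _ _ xa) (reg _ _ yb) x1 det1.
have w0 := frob_indep_neq0 ind cq rq.
have relw := frob_rel_shift cq rq rel.
have detw := frob_det_shift x y cq rq.
have wlE := ord_eq_ord P w0; set l := P _ in wlE.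
set w := y - iota c * x - iota r in w1 w0 relw detw wlE.
have l0 : 0 < l by move: w1; rewrite /ord_ge (negbTE w0).
have genw : generated_by iota x w.
  move=> S Sc SD SM SV Sx Sw; apply: gen => //.
  have -> : y = w + iota c * x + iota r by rewrite /w; ring.
  by apply: (SD) => //; apply: (SD) => //; apply: SM.
have du : d (x - iota a) = d x by rewrite (derB der) (der_const der) subr0.
have u0 : x - iota a != 0.
  by apply: contraNneq (chart_der ch) => h; rewrite -du h (der0 der).
have um := ord_eq_ord P u0; set m := P (x - iota a) in um.
have m0 : 0 < m by have := xa; rewrite /ord_ge (negbTE u0).
have x2 : ord_eq P m (x ^+ (q ^ 2) - x) by apply: frob_sub_fix um a2.
have ml := frob_rel_ord relw l0 x1 x2 wlE.
have [mE lE] := singular_uniformizer erefl a2 relw x1 um wlE m0 ml genw.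
rewrite mE in um x2; rewrite lE in wlE l0.
(* Although [x - a] is not a uniformizer, its order [q - 1] is prime to [q], so its powers up to
   exponent [q - 1] have distinct orders modulo [q]. *)
have cq1 : coprimez q (q%:Z - 1).
  by rewrite coprimezE; have -> : absz (q%:Z - 1) = q.-1 by [clear -q_gt2; lia];
     rewrite -{1}[q]prednK // coprimeSn.
have x2n : x ^+ (q ^ 2) != x by rewrite -subr_eq0 (ord_eq_neq0 x2).
have [dt0 dut] := ord_derivation charL qE q_gt1 um cq1
  (frob_span_chart a rel gen x2n) der dg Pt.
rewrite du in dut; split=> //.
have x31 : ord_eq P ((q%:Z - 1) * q%:Z) (x ^+ (q ^ 3) - x ^+ q).
  by rewrite frob_sub31 ord_eqX.
have x3 : ord_eq P 0 (x ^+ (q ^ 3) - x).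
  have -> : x ^+ (q ^ 3) - x = (x ^+ (q ^ 3) - x ^+ q) + (x ^+ q - x) by ring.
  apply: ord_eqDr x1; apply: ord_ge_le (ord_eq_ge x31).
  by clear -q_gt2; nia.
(* Replacing [y] by the tangent line [w] does not change [D2]. Of the two products in it, the first
   has order [q] and the second [2 q - 1]. *)
have detq : ord_eq P q%:Z (frob_det x y).
  rewrite -detw /frob_det; apply: ord_eqD.
    rewrite -[q%:Z]add0r; apply: ord_eqM x1 _; exact: frob_sub_param wlE.
  rewrite ord_geN //; have := frob_sub_param (ltn0Sn 0) l0 wlE; rewrite expn1.
  move=> /ord_eq_ge h; apply: ord_ge_le (ord_geM h (ord_eq_ge x2)).
  by clear -q_gt2; lia.
have := ord_eqM (ord_eqM detq (ord_eq_div x3 x31)) (ord_eqX q.+1 (ord_eq_div dut x1)).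
by congr ord_eq; clear -q_gt2; nia.
Qed.

Lemma chart_swap x y : chart x y -> chart y x.
Proof.
move=> [rel ind gen]; split.
- exact: frob_rel_sym.
- move=> c0 c1 c2 h0 h1 h2 h.
  by have [|-> -> ->] := ind c0 c2 c1 h0 h2 h1; rewrite // -[RHS]h; ring.
- by move=> S Sc SD SM SV Sy Sx; apply: gen.
Qed.

Lemma chart_inv x y : chart x y -> chart x^-1 (y / x).
Proof.
move=> [rel ind gen]; have [xq _] := chart_neq ind.
have x0 : x != 0 by apply: contraNneq xq => ->; rewrite expr0n gtn_eqF.
have x10 := expf_neq0 q x0; have x30 := expf_neq0 (q ^ 3) x0.
split.
- move: rel; rewrite /frob_rel !expr_div_n !exprVn => rel.
  apply/eqP; rewrite -subr_eq0; apply/eqP.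
  transitivity (((y ^+ (q ^ 3) - y) * (x ^+ q - x) - (x ^+ (q ^ 3) - x) * (y ^+ q - y))
    / (x * x ^+ q * x ^+ (q ^ 3))); last by rewrite rel subrr mul0r.
  by field; rewrite x0 x10 x30.
- move=> c0 c1 c2 h0 h1 h2 h; have [|-> -> ->] := ind c1 c0 c2 h1 h0 h2; last by [].
  by rewrite -[RHS](mulr0 x) -h; field.
- move=> S Sc SD SM SV Sx Sy; apply: gen => //; first by rewrite -[x]invrK; apply: SV.
  by rewrite -(divfK x0 y); apply: SM => //; rewrite -[x]invrK; apply: SV.
Qed.

(** On the curve [y^q - y], [y^(q^3) - y], [y^(q^3) - y^q] and [d y] are the same multiple, the
    slope of the tangent, of their counterparts in [x]. Only [D2] changes, by its sign. *)
Lemma wronskian_swap x y c : chart x y ->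
  wronskian y x (d y * c) = - wronskian x y (d x * c).
Proof.
move=> ch; have ch' := chart_swap ch; have [rel _ _] := ch.
have nz z z' k : chart z z' -> z ^+ (q ^ k.+1) - z != 0.
  by move=> h; rewrite subr_eq0 (chart_frob_neq k h).
have x1 := nz _ _ 0 ch; have y1 := nz _ _ 0 ch'.
rewrite expn1 in x1 y1.
have x31 : x ^+ (q ^ 3) - x ^+ q != 0 by rewrite frob_sub31 expf_neq0 ?(nz _ _ _ ch).
have y31 : y ^+ (q ^ 3) - y ^+ q != 0 by rewrite frob_sub31 expf_neq0 ?(nz _ _ _ ch').
rewrite /wronskian.
have -> : frob_det y x = - frob_det x y by rewrite /frob_det; ring.
have -> : (y ^+ (q ^ 3) - y) / (y ^+ (q ^ 3) - y ^+ q) =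
          (x ^+ (q ^ 3) - x) / (x ^+ (q ^ 3) - x ^+ q).
  apply/eqP; rewrite eqr_div //; apply/eqP.
  transitivity ((y ^+ (q ^ 3) - y) * (x ^+ (q ^ 3) - x) - (y ^+ (q ^ 3) - y) * (x ^+ q - x)).
    by ring.
  by rewrite -rel; ring.
have -> : d y * c / (y ^+ q - y) = d x * c / (x ^+ q - x).
  apply/eqP; rewrite eqr_div //; apply/eqP; apply: (mulIf x31).
  transitivity (c * (x ^+ q - x) * (d y * (x ^+ (q ^ 3) - x ^+ q))); first by ring.
  rewrite -(der_frob_rel rel).
  transitivity (c * d x * ((y ^+ (q ^ 3) - y ^+ q) * (x ^+ q - x))); first by ring.
  by rewrite -(frob_rel_sub rel); ring.
by rewrite !mulNr.
Qed.

(** The exponents of [x] are [-(1 + q + q^2)] from [D2], [q - 1] from the quotient and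
    [(q - 1) (q + 1)] from the differential. Their sum [-3] is what the term [3 V] compensates. *)
Lemma wronskian_inv x y c : chart x y ->
  wronskian x^-1 (y / x) (d x^-1 * c) = - wronskian x y (d x * c) / x ^+ 3.
Proof.
move=> ch; have [rel ind gen] := ch; have [xq _] := chart_neq ind.
have x0 : x != 0 by apply: contraNneq xq => ->; rewrite expr0n gtn_eqF.
have x1 : x ^+ q - x != 0 by rewrite subr_eq0.
have x31 : x ^+ (q ^ 3) - x ^+ q != 0.
  by rewrite frob_sub31 expf_neq0 // subr_eq0 (chart_frob_neq 1 ch).
have x10 := expf_neq0 q x0; have x20 := expf_neq0 (q ^ 2) x0.
have x30 := expf_neq0 (q ^ 3) x0.
rewrite /wronskian (derV der x0).
have -> : frob_det x^-1 (y / x) = - frob_det x y / (x * x ^+ q * x ^+ (q ^ 2)).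
  rewrite /frob_det !expr_div_n !exprVn.
  by field; rewrite x0 x10 x20.
have -> : (x^-1 ^+ (q ^ 3) - x^-1) / (x^-1 ^+ (q ^ 3) - x^-1 ^+ q) =
    (x ^+ (q ^ 3) - x) / (x ^+ (q ^ 3) - x ^+ q) * (x ^+ q / x).
  rewrite !exprVn; move: (x ^+ (q ^ 3)) (x ^+ q) x30 x10 x31 => z3 z1 z30 z10 z31.
  by field; rewrite x0 z10 z30 z31 mulN1r -opprB oppr_eq0 z31.
have -> : - d x / x ^+ 2 * c / (x^-1 ^+ q - x^-1) = d x * c / (x ^+ q - x) * (x ^+ q / x).
  rewrite !exprVn; move: (x ^+ q) x10 x1 => z1 z10 z11.
  by field; rewrite x0 z10 z11 mulN1r -opprB oppr_eq0 z11.
have xe : (x ^+ q / x) ^+ q.+1 = x ^+ (q ^ 2) / x.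
  by rewrite exprS expr_div_n -frob2E; field; rewrite x0 x10.
by rewrite exprMn xe; field; rewrite x0 x10 x20 x31.
Qed.

(** The order found outside F_(q^2) tests the first coordinate only. The relation expresses
    [y^(q^3) - y] as a regular multiple of [x^(q^3) - x], so the second coordinate follows. *)
Lemma chart_fix3 x y a b : chart x y ->
  ord_ge P 1 (x - iota a) -> ord_ge P 1 (y - iota b) ->
  a ^+ (q ^ 2) != a -> a ^+ (q ^ 3) = a -> b ^+ (q ^ 3) = b.
Proof.
move=> [rel _ _] xa yb a2 a3; apply: (frob_sub_fixP _ yb) => //.
have a1 : a ^+ (q ^ 1) != a by apply: contra a2 => /eqP aq; apply/eqP/frob_fixX.
have x1 := @frob_sub_unit x a 1 isT xa a1; rewrite expn1 in x1.
have -> : y ^+ (q ^ 3) - y = (x ^+ (q ^ 3) - x) * (y ^+ q - y) / (x ^+ q - x).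
  by rewrite rel mulfK // (ord_eq_neq0 x1).
rewrite -[1]addr0; apply: ord_geM; last exact/ord_eq_ge/ord_eqV0.
rewrite -[1]addr0; apply: ord_geM; first exact: frob_sub_fix_ge1 xa a3.
have y0 : ord_ge P 0 y by rewrite -(subrK (iota b) y) ord_geD ?ord_ge_const ?ord_gtW.
by apply: ord_geB => //; rewrite -[0](mul0r q%:Z) ord_geX.
Qed.

(** F_(q^2) and F_(q^3) meet in F_q, and no place is centered at a point over F_q. *)
Lemma chart_not_fixed x y a b : chart x y ->
  ord_ge P 1 (x - iota a) -> ord_ge P 1 (y - iota b) ->
  (a ^+ (q ^ 2) == a) && (b ^+ (q ^ 2) == b) ->
  (a ^+ (q ^ 3) == a) && (b ^+ (q ^ 3) == b) -> False.
Proof.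
move=> [rel ind _] xa yb /andP[/eqP a2 /eqP b2] /andP[/eqP a3 /eqP b3].
apply: (no_frob_fixed_center rel ind xa yb).
  by rewrite -{2}a3 frob3E a2.
by rewrite -{2}b3 frob3E b2.
Qed.

(** The coordinates are swapped where necessary, so that the first one lies outside F_(q^2) at [P],
    or outside F_q if both lie in F_(q^2). *)
Lemma wronskian_ord x y a b t : chart x y ->
  ord_ge P 1 (x - iota a) -> ord_ge P 1 (y - iota b) -> P t = 1 ->
  d t != 0 /\ ord_eq P
    (if (a ^+ (q ^ 2) == a) && (b ^+ (q ^ 2) == b) then q%:Z - 2 else
     if (a ^+ (q ^ 3) == a) && (b ^+ (q ^ 3) == b) then 1 else 0)
    (wronskian x y (d x / d t)).
Proof.
move=> ch xa yb Pt; have ch' := chart_swap ch; have [rel ind gen] := ch.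
have swap n : ord_eq P n (wronskian y x (d y / d t)) ->
              ord_eq P n (wronskian x y (d x / d t)).
  by rewrite wronskian_swap // ord_eqN.
have [a2|a2] := eqVneq (a ^+ (q ^ 2)) a; last first.
  have [dt h] := wronskian_nonsingular ch xa yb a2 Pt.
  split=> //; move: h; case: eqP => [a3|//].
  by rewrite (chart_fix3 ch xa yb a2 a3) eqxx.
have [b2|b2] := eqVneq (b ^+ (q ^ 2)) b; last first.
  have [dt h] := wronskian_nonsingular ch' yb xa b2 Pt.
  split=> //; apply: swap; move: h; rewrite /= andbC; case: eqP => [b3|//].
  by rewrite (chart_fix3 ch' yb xa b2 b3) eqxx.
have [a1|a1] := eqVneq (a ^+ q) a; last exact: wronskian_singular ch xa yb a2 b2 a1 Pt.
have [b1|b1] := eqVneq (b ^+ q) b.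
  by case: (no_frob_fixed_center rel ind xa yb a1 b1).
have [dt h] := wronskian_singular ch' yb xa b2 a2 b1 Pt.
by split=> //; apply: swap.
Qed.
End Derivation.
End Place.
End Chart.

(** * Hasse derivatives *)

Lemma det_mx33 (R : comNzRingType) (f : nat -> nat -> R) :
  \det (\matrix_(i < 3, j < 3) f i j) =
  f 0%N 0%N * (f 1%N 1%N * f 2%N 2%N - f 1%N 2%N * f 2%N 1%N)
  - f 0%N 1%N * (f 1%N 0%N * f 2%N 2%N - f 1%N 2%N * f 2%N 0%N)
  + f 0%N 2%N * (f 1%N 0%N * f 2%N 1%N - f 1%N 1%N * f 2%N 0%N).
Proof.
rewrite (expand_det_row _ 0) !big_ord_recl big_ord0 /cofactor.
rewrite !(expand_det_row _ 0) !big_ord_recl !big_ord0 /cofactor !det_mx11 !mxE /= /bump /=.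
by rewrite !add0n !add1n; ring.
Qed.

Section Hasse.
Variables (K L : fieldType) (iota : {rmorphism K -> L}) (p e q : nat).
Hypotheses (charL : p \in [pchar L]) (qE : q = (p ^ e)%N) (q_gt2 : (2 < q)%N).
Variables (x : L) (D : nat -> L -> L).
Hypothesis hasse : hasse_derivatives iota x D.

Let q_gt1 : (1 < q)%N. Proof. exact: ltnW. Qed.

Lemma hasseD i f g : D i (f + g) = D i f + D i g.
Proof. by case: hasse => _ /(_ i 1 f g) + _ _; rewrite rmorph1 !mul1r. Qed.

Lemma hasse0 i : D i 0 = 0.
Proof. by apply: (addrI (D i 0)); rewrite -hasseD !addr0. Qed.

Lemma hasse_derivation : derivation iota (D 1).
Proof.
case: hasse => h0 hl hm _; split=> [c f g|f g]; first exact: hl.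
by rewrite hm !big_ord_recl big_ord0 /= h0 addr0 [D 1%N f * _]mulrC h0.
Qed.

Lemma hasse_var : D 1 x = 1.
Proof. by case: hasse => _ _ _ /(_ 1%N 1%N); rewrite !expr1 binn. Qed.

Lemma hasse_q_var : D q x = 0.
Proof. by case: hasse => _ _ _ /(_ q 1%N); rewrite expr1 bin_small. Qed.

(* Compares coefficients in [(\sum_i D i f T^i)^q], by the Leibniz rule and by
   additivity of the [q]-th power. *)
Lemma hasse_frob f k : (k <= q)%N ->
  D k (f ^+ q) = if k == 0%N then f ^+ q else if k == q then D 1 f ^+ q else 0.
Proof.
case: hasse => h0 hl hm hx kq.
pose E : {poly L} := \poly_(i < q.+1) D i f.
have EX n i : (i <= q)%N -> (E ^+ n)`_i = D i (f ^+ n).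
  elim: n i => [|n IH] i iq.
    rewrite expr0 coef1; have := hx i 0%N; rewrite expr0 bin0n => ->.
    by case: i {iq} => [|i]; rewrite ?mulr0n //= expr0.
  rewrite !exprS hm coefM; apply: eq_bigr => j _.
  have ji := ltn_ord j; rewrite ltnS in ji.
  rewrite IH ?(leq_trans (leq_subr _ _)) // coef_poly ltnS.
  by rewrite (leq_trans ji iq).
rewrite -EX // /E poly_def.
have charP : p \in [pchar {poly L}] by apply: (rmorph_pchar (@polyC L)).
have -> : (\sum_(i < q.+1) D i f *: 'X^i) ^+ q = \sum_(i < q.+1) (D i f ^+ q) *: 'X^(i * q).
  rewrite (big_morph (fun g : {poly L} => g ^+ q) (id1 := 0) (op1 := +%R)).
  - by apply: eq_bigr => i _; rewrite exprZn exprM.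
  - by move=> g h; rewrite qE pchar_exprD.
  - by rewrite expr0n gtn_eqF // ltnW.
rewrite coef_sum.
under eq_bigr => i _ do rewrite coefZ coefXn.
have q0 : (0 < q)%N by exact: ltnW.
case: eqP => [->|k0].
  rewrite big_ord_recl /= ?mul0n ?eqxx mulr1 h0 big1 ?addr0 // => i _.
  by rewrite /bump /= add1n eq_sym muln_eq0 /= gtn_eqF // mulr0.
case: eqP => [->|kq'].
  rewrite (bigD1 (inord 1)) //= big1 ?addr0.
    by rewrite inordK // mul1n eqxx mulr1.
  move=> i i1; rewrite -[X in X == _]mul1n eqn_pmul2r //.
  case: eqP => [i1'|]; last by rewrite mulr0.
  by case/eqP: i1; apply/val_inj; rewrite /= inordK // -i1'.
rewrite big1 // => i _; case: eqP => [ki|]; last by rewrite mulr0.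
case: (nat_of_ord i) ki => [|[|j]] ki; first by case: k0; rewrite ki.
  by case: kq'; rewrite ki mul1n.
by move: kq; rewrite ki leqNgt; case/negP; rewrite -{1}[q]mul1n ltn_pmul2r.
Qed.

Lemma hasse_frobM m f : D q (m ^+ q * f) = m ^+ q * D q f + D 1 m ^+ q * f.
Proof.
have [h0 _ -> _] := hasse; have q0 : (0 < q)%N by exact: ltnW.
have qn0 : (ord_max : 'I_q.+1) != ord0 by rewrite -val_eqE /= gtn_eqF.
rewrite (bigD1 ord0) //= (bigD1 ord_max) //= big1 => [|i /andP[i0 iq]].
  by rewrite addr0 subn0 subnn !hasse_frob // !eqxx gtn_eqF // h0.
rewrite hasse_frob -1?ltnS // -[_ == 0%N]/(i == ord0) (negbTE i0).
by rewrite -[_ == q]/(i == ord_max) (negbTE iq) mul0r.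
Qed.

Lemma hasse_wronskian y : frob_rel q x y -> x ^+ q != x -> x ^+ (q ^ 2) != x ->
  D q y = frob_det q x y * ((x ^+ (q ^ 3) - x) / (x ^+ (q ^ 3) - x ^+ q))
          / (x ^+ q - x) ^+ q.+1.
Proof.
move=> rel x1 x2; have der := hasse_derivation.
have X1 : x ^+ q - x != 0 by rewrite subr_eq0.
have x31 : x ^+ (q ^ 3) - x ^+ q != 0.
  by rewrite (frob_sub31 charL qE) expf_neq0 // subr_eq0.
have frob1B := frob1B charL qE.
have D2 f : D 1 (f ^+ (q ^ 2)) = 0 by apply: (der_frobk charL qE q_gt2 der).
(* [s] is the slope of the tangent, so differences of [y] between the collinear points are [s] times
   those of [x]. The derivative [D q y] becomes [(s^q - s) (x^(q^3) - x) / (x^(q^3) - x^q)]. *)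
pose s := D 1 y.
have s31 : s * (x ^+ (q ^ 3) - x ^+ q) = y ^+ (q ^ 3) - y ^+ q.
  by have := der_frob_rel charL qE q_gt2 der rel; rewrite hasse_var mul1r.
have s1 : s * (x ^+ q - x) = y ^+ q - y.
  apply: (mulIf x31); rewrite mulrAC s31.
  by rewrite -(frob_rel_sub rel) mulrC.
have rel0 : (y - y ^+ (q ^ 2)) ^+ q * x + (x ^+ (q ^ 2) - x) ^+ q * y
            + (x * y ^+ (q ^ 2) - y * x ^+ (q ^ 2)) ^+ q * 1 = 0.
  rewrite !frob1B !exprMn -!frob3E.
  transitivity ((y ^+ (q ^ 3) - y) * (x ^+ q - x) - (x ^+ (q ^ 3) - x) * (y ^+ q - y)).
    by ring.
  by rewrite rel subrr.
have := congr1 (D q) rel0.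
rewrite !hasseD !hasse_frobM hasse0 hasse_q_var !(derB der) !(derM der) !D2 hasse_var.
have -> : D q 1 = 0 by case: hasse => _ _ _ /(_ q 0%N); rewrite expr0 bin0n gtn_eqF // ltnW.
rewrite -/s !mulr0 !add0r !subr0 !mulr1 -(frob_sub31 charL qE) !frob1B.
have -> : (-1) ^+ q = -1 :> L by rewrite qE (pchar_exprN e charL) expr1n.
rewrite exprMn -!frob3E => h.
have s3 : y ^+ (q ^ 3) - y = s * (x ^+ (q ^ 3) - x).
  apply: (mulIf X1); rewrite -rel -s1; ring.
have detE : frob_det q x y = (x ^+ q - x) ^+ q.+1 * (s ^+ q - s).
  by rewrite (frob_detE charL qE) -s1 exprMn exprS; ring.
rewrite detE; apply: (mulIf x31).
transitivity ((s ^+ q - s) * (x ^+ (q ^ 3) - x)).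
  apply/eqP; rewrite -subr_eq0; apply/eqP; rewrite -[RHS]h mulrBl -s3; ring.
by field; rewrite x31 expf_neq0.
Qed.
End Hasse.

(** * The function field of the curve *)

(** The shape of [D1(c, Y, 1)] and [D2(c, Y, 1)] as polynomials in [Y], with [k = c^q - c]. *)
Lemma size_frob_combination (K : fieldType) (k r : K) (m n : nat) :
  k != 0 -> (1 < m)%N -> (m < n)%N ->
  size (k%:P * ('X^n - 'X) - ('X^m - 'X) * r%:P) = n.+1.
Proof.
move=> k0 m1 mn.
have sX i : (1 < i)%N -> size ('X^i - 'X : {poly K}) = i.+1.
  by move=> i1; rewrite size_polyDl size_polyXn // size_polyN size_polyX ltnS.
rewrite size_polyDl; rewrite mul_polyC size_scale // sX ?(ltn_trans m1) //.
rewrite size_polyN mulrC mul_polyC (leq_ltn_trans (size_scale_leq _ _)) //.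
by rewrite sX.
Qed.

Section FunctionField.
Variables (p e q : nat) (Fq : finFieldType) (K : closedFieldType).
Variables (emb : {rmorphism Fq -> K}) (F : {mpoly K[3]}).
Variables (L : fieldType) (iota : {rmorphism K -> L}) (x y : L).
Hypotheses (p_prime : prime p) (qE : q = (p ^ e)%N) (q_gt2 : (2 < q)%N).
Hypotheses (card_Fq : #|{: Fq}| = q) (F_DGZ : DGZ_polynomial q F).
Hypothesis L_ff : function_field iota F x y.

Let q_gt1 : (1 < q)%N. Proof. exact: ltnW. Qed.
Let q_gt0 : (0 < q)%N. Proof. exact: ltnW. Qed.

Lemma pchar_closure : p \in [pchar K].
Proof.
by apply: (rmorph_pchar emb); apply: (@card_finPcharP _ p e); rewrite // -qE.
Qed.

Lemma pchar_function_field : p \in [pchar L].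
Proof. exact: (rmorph_pchar iota) pchar_closure. Qed.

Lemma frob_split_finite : exists r : seq K, all (fun c => c ^+ q == c) r /\
  forall f : L, f ^+ q - f = \prod_(c <- r) (f - iota c).
Proof.
exists [seq emb c | c : Fq]; split.
  by apply/allP => _ /mapP[c _ ->]; rewrite -rmorphXn -card_Fq expf_card.
move=> f; rewrite big_map big_enum /=.
have := congr1 (fun P : {poly Fq} => (map_poly (iota \o emb) P).[f]) (finField_genPoly Fq).
rewrite card_Fq rmorphB /= map_polyXn map_polyX hornerD hornerN hornerXn hornerX => ->.
rewrite rmorph_prod horner_prod; apply: eq_bigr => c _.
by rewrite rmorphB /= map_polyX map_polyC hornerD hornerN hornerX hornerC.
Qed.

Lemma closed_root (c : K) : exists b, c = b ^+ q.
Proof.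
have [b bE] := solve_monicpoly (fun i => if i == 0%N then c else 0) q_gt0.
exists b; rewrite bE (bigD1 (Ordinal q_gt0)) //= expr0 mulr1 big1 ?addr0 //.
by move=> i i0; rewrite -[_ == 0%N]/(i == Ordinal q_gt0) (negbTE i0) mul0r.
Qed.

(** The witness is a root of the Artin-Schreier equation [c^q = c + 1]. *)
Lemma not_frob_fixed : exists c : K, c ^+ q != c.
Proof.
have [c cE] := solve_monicpoly (fun i => if (i < 2)%N then 1 else 0 : K) q_gt0.
have i01 : Ordinal q_gt1 != Ordinal q_gt0 by [].
exists c; rewrite cE (bigD1 (Ordinal q_gt0)) // (bigD1 (Ordinal q_gt1)) //= big1.
  by rewrite addr0 expr0 !mul1r expr1 -subr_eq0 addrK oner_neq0.
move=> i /andP[i0 i1]; case: ltnP => [|_]; last by rewrite mul0r.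
move: i0 i1; rewrite -!val_eqE /=; by case: (nat_of_ord i) => [|[|]].
Qed.

(** The target ring is arbitrary because the determinants are evaluated both in [L] and, with the
    first variable constant, in [K[Y]]. *)
Lemma moore_eval (S : comNzRingType) (h : {rmorphism K -> S}) (u v : S) (s : seq nat) :
  mmap h (tnth [tuple u; v]) (moore K q s \mPo [tuple 'X_0; 'X_1; 1]) =
  \det (\matrix_(i < 3, j < 3) nth 0 [:: u; v; 1] i ^+ (q ^ nth 0%N s j)).
Proof.
rewrite -det_map_mx -det_map_mx; congr (\det _); apply/matrixP => i j.
rewrite !mxE /= !rmorphXn /= comp_mpolyXU; congr (_ ^+ _).
case: i => [[|[|[|//]]]] i3 /=; rewrite ?mmapX ?mmap1U ?rmorph1 //.
Qed.

Lemma function_field_generated : generated_by iota x y.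
Proof.
move=> S Sc SD SM SV Sx Sy f; have [_ /(_ f)[G [H [_ ->]]]] := L_ff.
have SX g n : S g -> S (g ^+ n).
  move=> Sg; elim: n => [|n IH]; first by rewrite expr0 -(rmorph1 iota).
  by rewrite exprS; apply: (SM).
have Seval J : S (mmap iota (tnth [tuple x; y]) J).
  rewrite /mmap; elim/big_rec: _ => [|m g _ Sg]; first by rewrite -(rmorph0 iota).
  apply: (SD) => //; apply: (SM) => //; rewrite /mmap1.
  elim/big_rec: _ => [|i r _ Sr]; first by rewrite -(rmorph1 iota).
  by apply: (SM) => //; apply: SX; case: i => [[|[|//]]].
by apply: (SM) => //; apply: (SV).
Qed.

Lemma function_field_frob_rel : frob_rel q x y.
Proof.
have [/(_ (D1 K q \mPo [tuple 'X_0; 'X_1; 1]))[_ bw] _] := L_ff.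
have : mmap iota (tnth [tuple x; y]) (D1 K q \mPo [tuple 'X_0; 'X_1; 1]) = 0.
  by apply: bw; exists (D2 K q \mPo [tuple 'X_0; 'X_1; 1]); rewrite -F_DGZ rmorphM mulrC.
rewrite moore_eval.
rewrite (det_mx33 (fun i j => nth 0 [:: x; y; 1] i ^+ (q ^ nth 0%N [:: 0; 1; 3]%N j))) /=.
rewrite !expr1n expn0 expn1 !expr1 => h.
apply/eqP; rewrite -subr_eq0; apply/eqP; rewrite -[RHS]oppr0 -h.
ring.
Qed.

(** A linear form [G] that vanishes on the curve satisfies [G D2 = H D1]. With [X] set to a constant
    [c] outside F_q, the left side has degree at most [q^2 + 1] in [Y] and the right side at least
    [q^3], unless [G(c, Y) = 0]. As [c] is not in F_q, all coefficients of [G] then vanish. *)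
Lemma function_field_indep : frob_indep iota q x y.
Proof.
move=> c0 c1 c2 q0 q1 q2 rel.
have [c cq] := not_frob_fixed.
pose G : {mpoly K[2]} := c0%:MP + c1%:MP * 'X_0 + c2%:MP * 'X_1.
have [/(_ G)[fw _] _] := L_ff.
have [|H GH] := fw.
  by rewrite /G !rmorphD !rmorphM /= !mmapC !mmapX !mmap1U.
pose t3 : 3.-tuple {mpoly K[2]} := [tuple 'X_0; 'X_1; 1].
have E : G * (D2 K q \mPo t3) = H * (D1 K q \mPo t3).
  by rewrite GH -F_DGZ rmorphM mulrA.
pose ev := mmap (@polyC K) (tnth [tuple c%:P; 'X]).
have evM (A B : {mpoly K[2]}) : ev (A * B) = ev A * ev B by rewrite /ev rmorphM.
have evD s := moore_eval (polyC : {rmorphism K -> {poly K}}) c%:P 'X s.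
pose R3 : {poly K} := (c ^+ q - c)%:P * ('X^(q ^ 3) - 'X) - ('X^q - 'X) * (c ^+ (q ^ 3) - c)%:P.
pose R2 : {poly K} := (c ^+ q - c)%:P * ('X^(q ^ 2) - 'X) - ('X^q - 'X) * (c ^+ (q ^ 2) - c)%:P.
have e3 : ev (D1 K q \mPo t3) = R3.
  apply: (etrans (evD [:: 0; 1; 3]%N)); rewrite /R3.
  rewrite (det_mx33 (fun i j => nth 0 [:: c%:P; 'X; 1] i ^+ (q ^ nth 0%N [:: 0; 1; 3]%N j))) /=.
  rewrite !expr1n expn0 expn1 !expr1 !polyCB !rmorphXn /=.
  ring.
have e2 : ev (D2 K q \mPo t3) = R2.
  apply: (etrans (evD [:: 0; 1; 2]%N)); rewrite /R2.
  rewrite (det_mx33 (fun i j => nth 0 [:: c%:P; 'X; 1] i ^+ (q ^ nth 0%N [:: 0; 1; 2]%N j))) /=.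
  rewrite !expr1n expn0 expn1 !expr1 !polyCB !rmorphXn /=.
  ring.
have eG : ev G = c0%:P + c1%:P * c%:P + c2%:P * 'X.
  by rewrite /ev /G !rmorphD !rmorphM /= !mmapC !mmapX !mmap1U.
have : ev G * ev (D2 K q \mPo t3) = ev H * ev (D1 K q \mPo t3).
  exact: etrans (esym (evM _ _)) (etrans (congr1 ev E) (evM _ _)).
rewrite e2 e3 eG; move: (ev H) => h.
have ltq n : (1 < n)%N -> (q < q ^ n)%N by move=> n1; rewrite -{1}[q]expn1 ltn_exp2l.
have cq' : c ^+ q - c != 0 by rewrite subr_eq0.
have size2 : size R2 = (q ^ 2).+1 by apply: size_frob_combination; rewrite ?ltq.
have size3 : size R3 = (q ^ 3).+1 by apply: size_frob_combination; rewrite ?ltq.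
have R20 : R2 != 0 by rewrite -size_poly_gt0 size2.
have R30 : R3 != 0 by rewrite -size_poly_gt0 size3.
clear -cq q_gt2 q0 q1 qE emb p_prime card_Fq size2 size3 R20 R30.
rewrite -polyCM -polyCD; set A := _ + _ * 'X => AR.
have A0 : A = 0.
  apply/eqP; apply/negPn/negP => A0.
  have h0 : h != 0.
    by apply: contraNneq (mulf_neq0 A0 R20) => h0; rewrite AR h0 mul0r.
  have := congr1 (fun f : {poly K} => size f) AR; rewrite !size_mul // size2 size3 !addnS /=.
  have : (size A <= 2)%N.
    by rewrite /A addrC size_MXaddC; case: ifP => // _; rewrite ltnS size_polyC leq_b1.
  move: h0; rewrite -size_poly_gt0; move: (size A) (size h) => sA sh sh0 sA2.
  by rewrite !expnS !expn0; clear -q_gt2 sA2 sh0; nia.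
have c20 : c2 = 0.
  by have := congr1 (coefp 1) A0; rewrite /coefp /A coefD coefC coefMX coefC coef0 add0r.
have c01 : c0 + c1 * c = 0.
  by have := congr1 (coefp 0) A0; rewrite /coefp /A coefD coefC coefMX coef0 addr0.
have [c10|c10] := eqVneq c1 0; first by move: c01; rewrite c10 mul0r addr0 => ->.
case/eqP: cq; have -> : c = - c0 / c1.
  by apply: (mulIf c10); rewrite divfK // mulrC; apply/eqP; rewrite -addr_eq0 addrC c01.
by rewrite expr_div_n qE (pchar_exprN e pchar_closure) -qE q0 q1.
Qed.

Variable D : nat -> L -> L.
Hypothesis hasse : hasse_derivatives iota x D.

Let charL := pchar_function_field.
Let K_root := closed_root.
Let split_q := frob_split_finite.

Lemma function_field_chart : chart iota q x y.
Proof.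
split; [exact: function_field_frob_rel|exact: function_field_indep|].
exact: function_field_generated.
Qed.

(** * From the chart containing the center to the ramification divisor *)

Section Ramification.
Variable P : place iota.

Let V : int := line_divisor x y (delta_mx 0 ord_max) P.

Lemma line_divisorE : V = - Num.min (Num.min (P x) (P y)) 0.
Proof.
rewrite /V /line_divisor !big_ord_recl big_ord0 !mxE /= /hcoord.
rewrite !rmorph0 !mul0r !add0r rmorph1 mul1r addr0.
by rewrite -[tnth _ _]/(1 : L) ord_one add0r.
Qed.

Lemma derivation_div (d : L -> L) c : derivation iota d -> derivation iota (fun f => d f * c).
Proof.
move=> der; split=> [k f g|f g].
  by case: der => -> _; ring.
by rewrite (derM der); ring.
Qed.

(** [X] and [Y] are the coordinates of an affine chart containing the center. The last hypothesis,
    with [c] for the inverse of [d t], says that returning to [x] and [y] costs exactly the term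
    [3 V] of the divisor. *)
Lemma ramification_chart (X Y : L) (a b : K) :
  chart iota q X Y -> ord_ge P 1 (X - iota a) -> ord_ge P 1 (Y - iota b) ->
  (forall d c g n, derivation iota d -> d g != 0 ->
    ord_eq P n (wronskian q X Y (d X * c)) ->
    ord_eq P (n - 3 * V) (wronskian q x y (d x * c))) ->
  [/\ (a ^+ (q ^ 2) == a) && (b ^+ (q ^ 2) == b) ->
        ramification_divisor q x y D P = q%:Z - 2,
      (a ^+ (q ^ 3) == a) && (b ^+ (q ^ 3) == b) ->
        ramification_divisor q x y D P = 1
    & ~~ ((a ^+ (q ^ 2) == a) && (b ^+ (q ^ 2) == b)) ->
      ~~ ((a ^+ (q ^ 3) == a) && (b ^+ (q ^ 3) == b)) ->
        ramification_divisor q x y D P = 0].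
Proof.
move=> chXY Xa Yb transfer.
have ord_at (d : L -> L) g t (der : derivation iota d) (dg : d g != 0) :=
  wronskian_ord charL qE q_gt2 split_q K_root der dg chXY Xa Yb (t := t).
have der1 := hasse_derivation hasse.
have d1x : D 1 x != 0 by rewrite (hasse_var hasse) oner_neq0.
have [t0 Pt0] := ord_onto P.
have [dt0 _] := ord_at _ _ _ der1 d1x Pt0.
rewrite /ramification_divisor /div_fun -/V.
(* [div_diff] selects the value at some pair [t], [d]. The order formula holds for every such pair,
   so only existence is at stake: [D 1] divided by its value at a local parameter gives one. *)
have [t [d [Pt der dt ->]]] : exists (t : L) (d : L -> L),
    [/\ P t = 1, derivation iota d, d t = 1 & div_diff x P = P (d x)].
  apply: (ClassicalEpsilon.epsilon_spec (inhabits (0 : int)) (fun n : int =>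
    exists (t : L) (d : L -> L), [/\ P t = 1, derivation iota d, d t = 1 & n = P (d x)])).
  exists (P (D 1 x * (D 1 t0)^-1)), t0, (fun f => D 1 f * (D 1 t0)^-1); split=> //.
    exact: derivation_div.
  by rewrite divff.
have dt1 : d t != 0 by rewrite dt oner_neq0.
have [_ /(transfer d _ t)] := ord_at _ _ _ der dt1 Pt.
move=> /(_ der dt1); rewrite dt divr1.
set n := (if _ then _ else _); move=> ordW.
have [xq _] := chart_neq charL qE q_gt2 split_q (let: And3 _ h _ := function_field_chart in h).
have WR : W_R q x y D = D q y.
  rewrite /W_R (det_mx33 (fun i j => nth 0 (nth [::] [:: [:: x; y; 1];
    [:: D 1%N x; D 1%N y; 0]; [:: D q x; D q y; 0]] i) j)) /=.
  by rewrite (hasse_var hasse) (hasse_q_var q_gt2 hasse); ring.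
have x2 : x ^+ (q ^ 2) != x.
  exact: (chart_frob_neq charL qE q_gt2 split_q der1 d1x 1 function_field_chart).
have WE : wronskian q x y (d x) = W_R q x y D * d x ^+ q.+1.
  rewrite WR (hasse_wronskian charL qE q_gt2 hasse function_field_frob_rel xq x2).
  by rewrite /wronskian expr_div_n; ring.
have [W0 dx0] : W_R q x y D != 0 /\ d x != 0.
  have := ord_eq_neq0 ordW; rewrite WE mulf_eq0 negb_or expf_eq0 /=.
  by case/andP.
have RE : P (W_R q x y D) + q.+1%:Z * P (d x) + 3 * V = n.
  have /ord_eqP := ord_eqM (ord_eq_ord P W0) (ord_eqX q.+1 (ord_eq_ord P dx0)).
  by rewrite -WE (ord_eqP ordW) [q.+1%:Z * _]mulrC => <-; rewrite subrK.
rewrite RE /n; split=> [->//|h3|/negbTE-> /negbTE-> //].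
case: ifP => h2; last by rewrite h3.
by case: (chart_not_fixed charL qE q_gt2 split_q chXY Xa Yb h2 h3).
Qed.

(** Ratios of coordinates eliminate the unknown factor [h] in the definition of the center. *)
Lemma center_ratio (h f g : L) (a b : K) : b != 0 ->
  ord_ge P 1 (h * f - iota a) -> ord_ge P 1 (h * g - iota b) ->
  ord_ge P 1 (f / g - iota (a / b)).
Proof.
move=> b0 hf hg.
have hg0 : ord_eq P 0 (h * g).
  by rewrite -(subrK (iota b) (h * g)); apply: ord_eqDr => //; apply: ord_eq_const.
have := ord_eq_neq0 hg0; rewrite mulf_eq0 negb_or => /andP[h0 g0].
have ib0 : iota b != 0 by rewrite fmorph_eq0.
have -> : f / g - iota (a / b) = ((h * f - iota a) * iota b - iota a * (h * g - iota b))
                                 * ((h * g)^-1 * iota b^-1).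
  by rewrite rmorphM !fmorphV; field; rewrite h0 g0 ib0.
rewrite -[1]addr0; apply: ord_geM.
  apply: ord_geB; first by rewrite -[1]addr0; apply: ord_geM => //; apply: ord_ge_const.
  by rewrite -[1]add0r; apply: ord_geM => //; apply: ord_ge_const.
rewrite -[0]addr0; apply: ord_geM; last exact: ord_ge_const.
exact/ord_eq_ge/ord_eqV0.
Qed.

Lemma vanishes_atE f : vanishes_at P f <-> ord_ge P 1 f.
Proof.
rewrite /vanishes_at /ord_ge -gtz0_ge1; split; first by case=> [->|->]; rewrite ?eqxx ?orbT.
by case/orP => [/eqP|]; [left|right].
Qed.

Lemma rational_pointP i (a : 'rV[K]_3) j k l : a 0 j != 0 ->
  (forall m, m \in [:: j; k; l]) ->
  rational_point q i a <->
  ((a 0 k / a 0 j) ^+ (q ^ i) == a 0 k / a 0 j) && ((a 0 l / a 0 j) ^+ (q ^ i) == a 0 l / a 0 j).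
Proof.
move=> aj all_jkl; split=> [[c c0 ca]|/andP[/eqP ak /eqP al]].
  have ratio m : a 0 m / a 0 j = (c * a 0 m) / (c * a 0 j) by field; rewrite c0 aj.
  by rewrite !ratio !expr_div_n !ca !eqxx.
exists (a 0 j)^-1; first by rewrite invr_eq0.
move=> m; rewrite mulrC; have := all_jkl m; rewrite !inE => /or3P[] /eqP-> //.
by rewrite divff // expr1n.
Qed.

Lemma ramification_divisor_center (a : 'rV[K]_3) : centered_at x y P a ->
  [/\ rational_point q 2 a -> ramification_divisor q x y D P = q%:Z - 2,
      rational_point q 3 a -> ramification_divisor q x y D P = 1
    & ~ rational_point q 2 a -> ~ rational_point q 3 a ->
        ramification_divisor q x y D P = 0].
Proof.
move=> [a0 [h cent]].
have [j aj] : exists j, a 0 j != 0.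
  apply/existsP; apply: contraNT a0; rewrite negb_exists => /forallP a0.
  by apply/eqP/rowP => j; rewrite mxE; apply/eqP; move: (a0 j); rewrite negbK.
have res k : ord_ge P 1 (hcoord x y k / hcoord x y j - iota (a 0 k / a 0 j)).
  by apply: (center_ratio aj) => //; apply/vanishes_atE.
have reg f c : ord_ge P 1 (f - iota c) -> ord_ge P 0 f.
  by move=> fc; rewrite -(subrK (iota c) f) ord_geD ?ord_ge_const ?ord_gtW.
have ch := function_field_chart; have ch' := chart_swap ch.
have nz z z' : chart iota q z z' -> z != 0.
  case=> _ ind _; have [+ _] := chart_neq charL qE q_gt2 split_q ind.
  by apply: contraNneq => ->; rewrite expr0n gtn_eqF.
have x0 := nz _ _ ch; have y0 := nz _ _ ch'.
have V_E := line_divisorE.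
have conclude k l : (forall m, m \in [:: j; k; l]) ->
    chart iota q (hcoord x y k / hcoord x y j) (hcoord x y l / hcoord x y j) ->
    (forall d c g n, derivation iota d -> d g != 0 ->
      ord_eq P n (wronskian q (hcoord x y k / hcoord x y j)
        (hcoord x y l / hcoord x y j) (d (hcoord x y k / hcoord x y j) * c)) ->
      ord_eq P (n - 3 * V) (wronskian q x y (d x * c))) -> 
  [/\ rational_point q 2 a -> ramification_divisor q x y D P = q%:Z - 2,
      rational_point q 3 a -> ramification_divisor q x y D P = 1
    & ~ rational_point q 2 a -> ~ rational_point q 3 a ->
        ramification_divisor q x y D P = 0].
  move=> jkl chkl transfer.
  have [r2 r3 r0] := ramification_chart chkl (res k) (res l) transfer.
  have rat i := rational_pointP i aj jkl.
  split=> [/rat|/rat|n2 n3] //; apply: r0; first by apply/negP => /rat.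
  by apply/negP => /rat.
pose i0 : 'I_3 := Ordinal (isT : 0 < 3)%N; pose i1 : 'I_3 := Ordinal (isT : 1 < 3)%N.
pose i2 : 'I_3 := Ordinal (isT : 2 < 3)%N.
have h0 : hcoord x y i0 = x by []. have h1 : hcoord x y i1 = y by [].
have h2 : hcoord x y i2 = 1 by [].
have cases (m : 'I_3) : [|| m == i0, m == i1 | m == i2] by case: m => [[|[|[|]]]].
(* In each chart [V] is minus the order of the coordinate function divided by, since that coordinate
   has the least order at [P]. *)
have [ej|ej|ej] := or3P (cases j); rewrite (eqP ej) in res conclude.
- have rx : ord_ge P 0 x^-1 by have := reg _ _ (res i2); rewrite h2 h0 div1r.
  have ry : ord_ge P 0 (y / x) by have := reg _ _ (res i1); rewrite h1 h0.
  have VE : V = - P x.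
    have := ord_eq_lt (ord_eqV (ord_eq_ord P x0)) rx.
    have := ord_eq_lt (ord_eq_div (ord_eq_ord P y0) (ord_eq_ord P x0)) ry.
    by rewrite V_E => *; lia.
  apply: (conclude i2 i1); rewrite ?h0 ?h1 ?h2 ?div1r.
  + by move=> m; rewrite !inE; have := cases m; case/or3P => ->; rewrite ?orbT.
  + exact: (chart_inv charL qE q_gt2 split_q ch).
  move=> d c g n der dg; rewrite (wronskian_inv charL qE q_gt2 split_q der dg c ch) mulNr ord_eqN.
  move=> /ord_eqM/(_ (ord_eqX 3 (ord_eq_ord P x0))); rewrite divfK ?expf_neq0 //.
  by congr ord_eq; rewrite VE; lia.
- have ry : ord_ge P 0 y^-1 by have := reg _ _ (res i2); rewrite h2 h1 div1r.
  have rx : ord_ge P 0 (x / y) by have := reg _ _ (res i0); rewrite h1 h0.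
  have VE : V = - P y.
    have := ord_eq_lt (ord_eqV (ord_eq_ord P y0)) ry.
    have := ord_eq_lt (ord_eq_div (ord_eq_ord P x0) (ord_eq_ord P y0)) rx.
    by rewrite V_E => *; lia.
  apply: (conclude i2 i0); rewrite ?h0 ?h1 ?h2 ?div1r.
  + by move=> m; rewrite !inE; have := cases m; case/or3P => ->; rewrite ?orbT.
  + exact: (chart_inv charL qE q_gt2 split_q ch').
  move=> d c g n der dg; rewrite (wronskian_inv charL qE q_gt2 split_q der dg c ch') mulNr ord_eqN.
  rewrite (wronskian_swap charL qE q_gt2 split_q der dg c ch) mulNr ord_eqN.
  move=> /ord_eqM/(_ (ord_eqX 3 (ord_eq_ord P y0))); rewrite divfK ?expf_neq0 //.
  by congr ord_eq; rewrite VE; lia.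
have rx : ord_ge P 0 x by have := reg _ _ (res i0); rewrite h2 h0 divr1.
have ry : ord_ge P 0 y by have := reg _ _ (res i1); rewrite h1 h2 divr1.
have VE : V = 0.
  have := ord_eq_lt (ord_eq_ord P x0) rx; have := ord_eq_lt (ord_eq_ord P y0) ry.
  by rewrite V_E => *; lia.
apply: (conclude i0 i1); rewrite ?h0 ?h1 ?h2 ?divr1 //.
  by move=> m; rewrite !inE; have := cases m; case/or3P => ->; rewrite ?orbT.
by move=> d c g n der dg; rewrite VE mulr0 subr0.
Qed.
End Ramification.
End FunctionField.

(* K is an algebraic closure of the field Fq with q elements. *)
Theorem proposition8p6 (p e q : nat) (Fq : finFieldType) (K : closedFieldType)
    (emb : {rmorphism Fq -> K}) (F : {mpoly K[3]})
    (L : fieldType) (iota : {rmorphism K -> L}) (x y : L) (D : nat -> L -> L) :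
  prime p -> q = (p ^ e)%N -> (3 <= q)%N ->
  #|{: Fq}| = q -> (forall a : K, algebraicOver emb a) ->
  DGZ_polynomial q F ->
  function_field iota F x y ->
  hasse_derivatives iota x D ->
  let R : divisor iota := ramification_divisor q x y D in
  forall (a : 'rV[K]_3) (P : place iota),
    on_curve F a -> centered_at x y P a ->
    [/\ curve_points q F 2 a -> R P = q%:Z - 2,
        curve_points q F 3 a -> R P = 1
      & ~ curve_points q F 2 a -> ~ curve_points q F 3 a -> R P = 0].
Proof.
move=> p_prime qE q_gt2 card_Fq _ F_DGZ L_ff hasse R a P on_a cent.
have [r2 r3 r0] := ramification_divisor_center emb p_prime qE q_gt2 card_Fq F_DGZ L_ff hasse cent.
split=> [[_ /r2]|[_ /r3]|n2 n3] //.
by apply: r0 => r; [apply: n2|apply: n3].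
Qed.
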